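(* Let $\mathcal{O}$ be a Euclidean oriented matroid on $E$ and let $\mathcal{O}'=\mathcal{O}[e_1^{\alpha_1},\dots,e_k^{\alpha_k}]$ be any lexicographic extension of $\mathcal{O}$ ($[e_1,\dots,e_k]$ an ordered subset of $E$, $\alpha\in\{+,-\}^k$). Then $\mathcal{O}'$ is Euclidean.
   Context: Let $\mathcal{O}$ be an oriented matroid of rank $r$ on a finite ground set $E$, given by its set of cocircuits (sign vectors in $\{+,-,0\}^E$). For sign vectors $X,Y$: $\operatorname{supp}(X)=\{e:X_e\neq 0\}$, $z(X)=E\setminus\operatorname{supp}(X)$, $\operatorname{sep}(X,Y)=\{e: X_e=-Y_e\neq 0\}$, $(X\circ Y)_e=X_e$ if $X_e\neq 0$ and $(X\circ Y)_e=Y_e$ otherwise; $X,Y$ are conformal if $\operatorname{sep}(X,Y)=\emptyset$. An edge is a covector $F$ whose zero set $z(F)$ is a flat of rank $r-2$ of the underlying matroid. Two cocircuits $X\neq\pm Y$ are comodular if $X\circ Y$ is an edge. For comodular cocircuits $X,Y$ and $e\in\operatorname{sep}(X,Y)$ there is a unique cocircuit $Z$ with $Z_e=0$ and $Z_h=(X\circ Y)_h$ for all $h\notin\operatorname{sep}(X,Y)$ (''cocircuit elimination of $e$ between $X$ and $Y$''). An oriented matroid program is a triple $(\mathcal{O},g,f)$ with $g\neq f\in E$, $g$ not a loop, $f$ not a coloop. For comodular cocircuits $X,Y$ with $X_g=Y_g\neq 0$ let $Z$ be obtained by eliminating $g$ between $-X$ and $Y$; write $X\to_{g,f}Y$ if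 $Z_f=+$, $X\leftarrow_{g,f}Y$ if $Z_f=-$, and $X\leftrightarrow_{g,f}Y$ if $Z_f=0$. The cocircuit graph $G_f$ of $(\mathcal{O},g,f)$ has as vertices the cocircuits $X$ with $X_g=+$ and as edges the pairs of conformal comodular such cocircuits, oriented as described. A directed cycle in $G_f$ is a sequence $P^1,\dots,P^n=P^1$ of vertices with $P^1,\dots,P^{n-1}$ pairwise distinct, $\{P^i,P^{i+1}\}$ an edge, $P^i\to P^{i+1}$ or $P^i\leftrightarrow P^{i+1}$ for all $i$, and $P^i\to P^{i+1}$ for at least one $i$. The program is Euclidean if $G_f$ has no directed cycle. An oriented matroid is Euclidean if every oriented matroid program on it is Euclidean. A single-element extension $\mathcal{O}\cup p$ is determined by a localization $\sigma$ from cocircuits of $\mathcal{O}$ to $\{+,-,0\}$. For an ordered subset $I=[e_1,\dots,e_k]$ of $E$, the index of a cocircuit $Y$ w.r.t. $I$ is the smallest $i$ with $Y_{e_i}\neq 0$, or $k+1$ if none. For $\alpha\in\{+,-\}^k$ the lexicographic extension $\mathcal{O}[e_1^{\alpha_1},\dots,e_k^{\alpha_k}]=\mathcal{O}\cup p$ is the single-element extension with localization $\sigma(Y)=\alpha_iY_{e_i}$ if the index $i$ of $Y$ is $\le k$, and $\sigma(Y)=0$ otherwise. *)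

(* Defs.v *)
From HB Require Import structures.
From mathcomp Require Import all_boot.
Set Implicit Arguments. Unset Strict Implicit. Unset Printing Implicit Defensive.

Inductive sgn := Pos | Neg | Zer.

Definition sgn_to (s : sgn) : option bool :=
  match s with Pos => Some true | Neg => Some false | Zer => None end.
Definition sgn_of (o : option bool) : sgn :=
  match o with Some true => Pos | Some false => Neg | None => Zer end.
Lemma sgn_toK : cancel sgn_to sgn_of. Proof. by case. Qed.
HB.instance Definition _ := Finite.copy sgn (can_type sgn_toK).

Definition sopp (s : sgn) : sgn :=
  match s with Pos => Neg | Neg => Pos | Zer => Zer end.
Definition smul (a b : sgn) : sgn :=
  match a, b with
  | Zer, _ | _, Zer => Zer
  | Pos, x => x
  | Neg, x => sopp x
  end.

Definition signvec (T : finType) := {ffun T -> sgn}.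

Section SignVectors.
Variable T : finType.
Implicit Types X Y Z F : signvec T.

Definition zerov : signvec T := [ffun => Zer].
Definition oppv X : signvec T := [ffun e => sopp (X e)].
Definition supp X : {set T} := [set e | X e != Zer].
Definition zset X : {set T} := [set e | X e == Zer].
Definition sep X Y : {set T} := [set e | (X e != Zer) && (X e == sopp (Y e))].
Definition compose X Y : signvec T :=
  [ffun e => if X e != Zer then X e else Y e].
Definition conformal X Y : Prop := sep X Y = set0.

(* Cocircuit axioms for an oriented matroid (set of cocircuits C). *)
Definition is_OM (C : {set signvec T}) : Prop :=
  [/\ (forall X, X \in C -> X <> zerov),
      (forall X, X \in C -> oppv X \in C),
      (forall X Y, X \in C -> Y \in C -> supp X \subset supp Y ->
           X = Y \/ X = oppv Y)
    & (forall X Y e, X \in C -> Y \in C -> X <> oppv Y -> e \in sep X Y ->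
         exists2 Z, Z \in C &
           [/\ Z e = Zer,
               (forall h, Z h = Pos -> X h = Pos \/ Y h = Pos) &
               (forall h, Z h = Neg -> X h = Neg \/ Y h = Neg)])].

Definition covector (C : {set signvec T}) F : Prop :=
  exists2 s : seq (signvec T), all (fun X => X \in C) s & F = foldr compose zerov s.

(* Underlying matroid: its cocircuits are the supports of the cocircuits.
   S is spanning iff S meets every cocircuit; bases are minimal spanning sets;
   independent sets are subsets of bases; rank is the usual matroid rank. *)
Definition spanning (C : {set signvec T}) (S : {set T}) : bool :=
  [forall X in C, ~~ [disjoint S & supp X]].
Definition basis (C : {set signvec T}) (B : {set T}) : bool :=
  minset (spanning C) B.
Definition indep (C : {set signvec T}) (I : {set T}) : bool :=
  [exists B, basis C B && (I \subset B)].
Definition mrank (C : {set signvec T}) (A : {set T}) : nat :=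
  \max_(I : {set T} | (I \subset A) && indep C I) #|I|.
Definition om_rank (C : {set signvec T}) : nat := mrank C setT.

Definition is_loop (C : {set signvec T}) (e : T) : Prop :=
  forall X, X \in C -> X e = Zer.
Definition is_coloop (C : {set signvec T}) (e : T) : Prop :=
  exists2 X, X \in C & supp X = [set e].

Definition is_edge (C : {set signvec T}) F : Prop :=
  covector C F /\ mrank C (zset F) + 2 = om_rank C.

Definition comodular (C : {set signvec T}) X Y : Prop :=
  [/\ X \in C, Y \in C, X <> Y, X <> oppv Y & is_edge C (compose X Y)].

Definition elim_result (C : {set signvec T}) X Y (e : T) Z : Prop :=
  [/\ Z \in C, Z e = Zer &
      forall h, h \notin sep X Y -> Z h = compose X Y h].

(* Orientation of the cocircuit graph of the program (O, g, f):
   eliminate g between -X and Y, look at the f-entry of the result. *)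
Definition arrow_sign (C : {set signvec T}) (g f : T) X Y (s : sgn) : Prop :=
  exists2 Z, elim_result C (oppv X) Y g Z & Z f = s.

Definition cg_vertex (C : {set signvec T}) (g : T) X : Prop :=
  X \in C /\ X g = Pos.

Definition cg_edge (C : {set signvec T}) (g : T) X Y : Prop :=
  [/\ cg_vertex C g X, cg_vertex C g Y, conformal X Y & comodular C X Y].

Definition cg_to (C : {set signvec T}) (g f : T) X Y : Prop :=
  cg_edge C g X Y /\ arrow_sign C g f X Y Pos.
Definition cg_both (C : {set signvec T}) (g f : T) X Y : Prop :=
  cg_edge C g X Y /\ arrow_sign C g f X Y Zer.

(* A directed cycle P^1,...,P^n = P^1, given by the list s = [P^1;...;P^{n-1}]
   of pairwise distinct vertices (indices taken cyclically). *)
Definition directed_cycle (C : {set signvec T}) (g f : T) : Prop :=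
  exists s : seq (signvec T),
    [/\ s <> [::], uniq s,
        (forall i, i < size s ->
           cg_to C g f (nth zerov s i) (nth zerov s (i.+1 %% size s)) \/
           cg_both C g f (nth zerov s i) (nth zerov s (i.+1 %% size s))) &
        (exists2 i, i < size s &
           cg_to C g f (nth zerov s i) (nth zerov s (i.+1 %% size s)))].

Definition is_program (C : {set signvec T}) (g f : T) : Prop :=
  [/\ g <> f, ~ is_loop C g & ~ is_coloop C f].

Definition euclidean_program (C : {set signvec T}) (g f : T) : Prop :=
  ~ directed_cycle C g f.

Definition euclidean_OM (C : {set signvec T}) : Prop :=
  forall g f, is_program C g f -> euclidean_program C g f.

End SignVectors.

Section Extensions.
Variable T : finType.
Implicit Types X Y : signvec T.

(* the ground set of O u p is option T, with p := None *)
Definition restr (Y : signvec (option T)) : signvec T := [ffun e => Y (Some e)].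
Definition extendv X (s : sgn) : signvec (option T) :=
  [ffun o => match o with Some e => X e | None => s end].

Definition deletion_p (C' : {set signvec (option T)}) : {set signvec T} :=
  [set X : signvec T | [&& X != (zerov T), [exists Y' in C', restr Y' == X] &
     [forall Y' in C', (restr Y' != (zerov T)) ==>
         ~~ (supp (restr Y') \proper supp X)]]].

Definition is_extension (C : {set signvec T}) (C' : {set signvec (option T)})
    (sigma : signvec T -> sgn) : Prop :=
  [/\ is_OM C', deletion_p C' = C, om_rank C' = om_rank C &
      forall Y, Y \in C -> extendv Y (sigma Y) \in C'].

(* index of Y w.r.t. es (0-based: size es means "k+1") *)
Definition lex_index (es : seq T) Y : nat := find (fun e => Y e != Zer) es.

Definition lex_sigma (es : seq T) (alpha : seq sgn) Y : sgn :=
  let i := lex_index es Y in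
  match onth es i with
  | Some e => smul (nth Zer alpha i) (Y e)
  | None => Zer
  end.

Definition is_lex_extension (C : {set signvec T}) (C' : {set signvec (option T)})
    (es : seq T) (alpha : seq sgn) : Prop :=
  [/\ uniq es, size alpha = size es, all (fun a => a != Zer) alpha &
      is_extension C C' (lex_sigma es alpha)].
End Extensions.

(* Main.v *)
Require Import Defs.
From mathcomp Require Import all_boot.
From Stdlib Require Import Classical ClassicalEpsilon ZArith Lia.
Set Implicit Arguments. Unset Strict Implicit. Unset Printing Implicit Defensive.

(** Acyclicity is witnessed by potentials: integer functions on the cocircuits off [g] that
    increase along strict arrows and are constant along the undirected edges of [G_f].  One
    should think of a potential as the value [f/g]; on a line it compares any two points,
    conformal or not.  A cocircuit [Z] of the extension that does not come from [O] is
    infinitely near a cocircuit [Y] of [O]: it equals [Y + t W] with [W] at infinity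
    ([W_g = 0]) and [p(Y) + t p(W) = 0], so that
    [f/g (Z) = f/g (Y) + |p|/g (Y) * f/|p| (W)].
    As [p] is lexicographic, the second term only matters when the first ones agree, and each
    of its factors is compared by means of the potentials of the programs [(O, g, e_l)] and
    [(O, f, e_l)].  Along an edge inside [p = 0] either [Y] is fixed, or the leading term of
    [f/|p| (W)] is, so ordering by [f/g (Y)], then by the leading term of [f/|p| (W)], then by
    [|p|/g (Y)] and finally by [f/|p| (W)] gives a potential of the extension. *)

(** A potential is only an order, so the product in the second term cannot be formed: its factors
    are listed one after the other in a single lexicographic key. What makes this work is the
    geometry of an edge Z, Z' inside p = 0. Dropping p from its flat leaves a plane (corank at most
    three). Let [a] be the first lexicographic element that does not vanish on the whole edge. In
    this plane p = 0 is infinitely close to the line a = 0, so all near points lie on a = 0, and all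
    points at infinity lie on g = 0. If the near points differ, their difference Q is the common
    point of these two lines, and it is infinitely near the point U at infinity of the edge. When
    Q_f is not zero it is already U_f; when Q_f = 0, the elements f and [a] are parallel at
    infinity, so that U_f is known from U_a, and U_a from signs at p. The programs with p as f or as
    g need no near points: p/g is ordered by the sequence of all e_l/g, and f/p through the inverse
    of p/f. *)

Definition add3 (x y z : sgn) : Prop :=
  match x, y with
  | Zer, _ => z = y
  | _, Zer => z = x
  | Pos, Pos => z = Pos
  | Neg, Neg => z = Neg
  | _, _ => True
  end.

(* [Z] lies in the hyperfield sum of [X] and [Y]: the sign condition of cocircuit elimination. *)
Definition vsum (T : finType) (X Y Z : signvec T) : Prop :=
  forall h, add3 (X h) (Y h) (Z h).

Ltac sgn_split :=
  simpl in *; subst; try discriminate; try contradiction; try congruence;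
  match goal with
  | s : sgn |- _ => destruct s; sgn_split
  | _ => intuition congruence
  end.

Ltac sgn_solve :=
  repeat match goal with
  | H : @eq sgn _ _ |- _ => revert H
  | H : ~ (@eq sgn _ _) |- _ => revert H
  | H : add3 _ _ _ |- _ => revert H
  end;
  rewrite ?ffunE;
  repeat match goal with
  | |- context [@fun_of_fin ?a ?b ?c ?X ?h] => generalize (@fun_of_fin a b c X h)
  end;
  clear; intros; sgn_split.

Lemma soppK : involutive sopp. Proof. by case. Qed.

(** * Sign vectors and their hyperfield sums *)

Section Vectors.
Variable T : finType.
Implicit Types X Y Z W : signvec T.

Lemma oppvE X h : oppv X h = sopp (X h).
Proof. by rewrite ffunE. Qed.

Lemma oppvK X : oppv (oppv X) = X.
Proof. by apply/ffunP => h; rewrite !ffunE soppK. Qed.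

Lemma zsetP X h : reflect (X h = Zer) (h \in zset X).
Proof. by rewrite inE; apply: eqP. Qed.

Lemma subzP (A : {set T}) X :
  reflect (forall h, h \in A -> X h = Zer) (A \subset zset X).
Proof.
apply: (iffP subsetP) => H h hA; first exact/zsetP/H.
exact/zsetP/H.
Qed.

Lemma subz_opp (A : {set T}) X : A \subset zset (oppv X) = (A \subset zset X).
Proof.
apply/subzP/subzP => H h /H; rewrite ?ffunE; last by move->.
by case: (X h).
Qed.

Lemma vsum_opp X Y Z : vsum X Y Z -> vsum (oppv X) (oppv Y) (oppv Z).
Proof. by move=> H h; move: (H h); sgn_solve. Qed.

Lemma vsum_oppr X W Y : vsum X W Y -> vsum Y (oppv W) X.
Proof. by move=> H h; move: (H h); sgn_solve. Qed.

Lemma vsum_oppl X W Y : vsum (oppv X) Y W -> vsum X W Y.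
Proof. by move=> H h; move: (H h); sgn_solve. Qed.

Lemma zset_compose X Y : zset (compose X Y) = zset X :&: zset Y.
Proof.
apply/setP => h; rewrite !inE ffunE.
by case: (X h); case: (Y h).
Qed.

(** Moving -X to the other side, the result of the elimination is the point at infinity that leads
    from X to Y; arrows thereby become comparisons along a line. *)
Lemma elim_resultP (C : {set signvec T}) X Y e Z :
  elim_result C (oppv X) Y e Z <-> [/\ Z \in C, Z e = Zer & vsum X Z Y].
Proof.
split=> -[ZC Ze H]; split=> // h.
  move: (H h); rewrite !inE !ffunE.
  by case: (X h); case: (Y h); case: (Z h) => //= /(_ isT).
move: (H h); rewrite !inE !ffunE.
by case: (X h); case: (Y h); case: (Z h).
Qed.

End Vectors.

(** * Cocircuit elimination without signs *)

Section Rank.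
Variables (T : finType) (C : {set signvec T}).
Hypothesis OMC : is_OM C.
Implicit Types (X Y Z W : signvec T) (A B I J : {set T}).

Lemma om_opp X : X \in C -> oppv X \in C.
Proof. by case: OMC => _ H _ _; apply: H. Qed.

Lemma om_oppE X : (oppv X \in C) = (X \in C).
Proof. by apply/idP/idP => /om_opp //; rewrite oppvK. Qed.

Lemma om_incomp X Y : X \in C -> Y \in C -> zset X \subset zset Y ->
  Y = X \/ Y = oppv X.
Proof.
move=> XC YC /subsetP s; case: OMC => _ _ H _; apply: H => //.
apply/subsetP => h; apply: contraLR; rewrite !inE !negbK => Xh.
by have := s h; rewrite !inE; apply.
Qed.

Lemma om_nz X : X \in C -> exists h, X h <> Zer.
Proof.
move=> XC; apply: NNPP => N; case: OMC => H _ _ _; apply: (H _ XC).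
by apply/ffunP => h; rewrite ffunE; apply: NNPP => E; apply: N; exists h.
Qed.

Lemma om_weak_elim X Y e : X \in C -> Y \in C -> ~ (zset X = zset Y) ->
    X e <> Zer -> Y e <> Zer ->
  exists2 Z, Z \in C & Z e = Zer /\ zset X :&: zset Y \subset zset Z.
Proof.
move=> XC YC n Xe Ye.
have [Y' [Y'C zY' Y'e]] : exists Y', [/\ Y' \in C, zset Y' = zset Y & Y' e = sopp (X e)].
  case: (boolP (Y e == sopp (X e))) => [/eqP E|E]; first by exists Y.
  exists (oppv Y); rewrite om_oppE; split=> //.
    by apply/setP => h; rewrite !inE ffunE; case: (Y h).
  by rewrite ffunE; move: E Xe Ye; case: (X e); case: (Y e).
case: OMC => _ _ _ /(_ X Y' e XC Y'C) [||Z ZC [Ze Zp Zn]].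
- by move=> E; apply: n; rewrite E -zY'; apply/setP => h; rewrite !inE ffunE; case: (Y' h).
- by rewrite inE Y'e soppK eqxx andbT; apply/eqP.
exists Z => //; split=> //; apply/subsetP => h; rewrite -zY' !inE => /andP[/eqP Xh /eqP Yh].
move: (Zp h) (Zn h); rewrite Xh Yh; case: (Z h) => //.
  by case=> // /esym; case.
by move=> _; case=> // /esym; case.
Qed.

(* The classical derivation of strong from weak circuit elimination, by
   induction on the size of the union of the supports. *)
Lemma om_strong_elim X Y h e : X \in C -> Y \in C ->
    X h <> Zer -> Y h <> Zer -> X e = Zer -> Y e <> Zer ->
  exists2 Z, Z \in C & [/\ Z h = Zer, Z e <> Zer & zset X :&: zset Y \subset zset Z].
Proof.
have [n] := ubnP #|~: (zset X :&: zset Y)|.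
elim: n X Y h e => // n IH X Y h e; rewrite ltnS => le XC YC Xh Yh Xe Ye.
have nXY : ~ (zset X = zset Y).
  by move=> /setP/(_ e); rewrite !inE Xe; move: Ye; case: (Y e).
have [Z ZC [Zh sZ]] := om_weak_elim XC YC nXY Xh Yh.
case: (boolP (Z e == Zer)) => [/eqP Ze|/eqP Ze]; last by exists Z.
have [k [Zk Yk]] : exists k, Z k <> Zer /\ Y k = Zer.
  apply: NNPP => N.
  have : zset Y \subset zset Z.
    apply/subsetP => k; rewrite !inE => /eqP Yk; apply/eqP.
    by apply: NNPP => E; apply: N; exists k.
  by case/(om_incomp YC ZC) => E; move: Yh Zh; rewrite E ?ffunE; case: (Y h).
have Xk : X k <> Zer.
  by move=> Xk; apply: Zk; move/subzP: sZ; apply; rewrite !inE Xk Yk.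
have smaller W1 W2 q : zset X :&: zset Y \subset zset W1 :&: zset W2 ->
    X q <> Zer \/ Y q <> Zer -> W1 q = Zer -> W2 q = Zer ->
    #|~: (zset W1 :&: zset W2)| < n.
  move=> s nq q1 q2; apply: leq_trans le; apply: proper_card.
  rewrite properEneq setCS s andbT; apply/eqP => /setP/(_ q).
  rewrite !inE q1 q2 /=; by case: nq; [case: (X q)|case: (Y q) => // _; rewrite andbF].
have [X' X'C [X'k X'h X'e sX']] : exists2 Z, Z \in C &
    [/\ Z k = Zer, Z h <> Zer, Z e = Zer & zset X :&: zset Y \subset zset Z].
  have [|W WC [Wk Wh sW]] // := IH Z X k h _ ZC XC Zk Xk Zh Xh.
    apply: (smaller _ _ e) => //; last by right.
    by rewrite subsetI sZ subsetIl.
  exists W => //; split=> //.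
    by move/subzP: sW; apply; rewrite !inE Xe Ze.
  by apply: subset_trans sW; rewrite subsetI sZ subsetIl.
have [|W WC [Wh We sW]] // := IH X' Y h e _ X'C YC X'h Yh X'e Ye.
  apply: (smaller _ _ k) => //; last by left.
  by rewrite subsetI sX' subsetIr.
exists W => //; split=> //; apply: subset_trans sW.
by rewrite subsetI sX' subsetIr.
Qed.

(** * Rank and corank *)

(** The intersection of the hyperplanes that contain [A], hyperplanes being the zero sets of
    cocircuits. *)
Definition clos A : {set T} :=
  [set e | [forall X in C, (A \subset zset X) ==> (X e == Zer)]].

Lemma closP A e :
  reflect (forall X, X \in C -> A \subset zset X -> X e = Zer) (e \in clos A).
Proof.
rewrite inE; apply: (iffP forallP) => H X.
  by move=> XC sA; move/implyP: (H X) => /(_ XC) /implyP/(_ sA)/eqP.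
by apply/implyP => XC; apply/implyP => sA; apply/eqP/H.
Qed.

Lemma closPn A e : e \notin clos A ->
  exists X, [/\ X \in C, A \subset zset X & X e <> Zer].
Proof.
move=> H; apply: NNPP => N; case/closP: H => X XC sA.
by apply: NNPP => E; apply: N; exists X.
Qed.

Lemma sub_clos A : A \subset clos A.
Proof. by apply/subsetP => e eA; apply/closP => X _ /subzP; apply. Qed.

Lemma clos_min A B : A \subset clos B -> clos A \subset clos B.
Proof.
move=> s; apply/subsetP => e /closP H; apply/closP => X XC sB; apply: H => //.
by apply/subzP => h /(subsetP s)/closP; apply.
Qed.

Lemma closS A B : A \subset B -> clos A \subset clos B.
Proof. by move=> s; apply/clos_min/(subset_trans s)/sub_clos. Qed.

(** A counterexample X vanishes at e but not at h; strong elimination of h against a cocircuit that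
    avoids A and sees e would keep e, contrary to the second hypothesis. *)
Lemma clos_exchange A e h : e \notin clos A -> e \in clos (h |: A) -> h \in clos (e |: A).
Proof.
case/closPn => Y [YC sY Ye] /closP He; apply/closP => X XC.
rewrite subUset sub1set => /andP[/zsetP Xe sX]; apply: NNPP => Xh.
have Yh : Y h <> Zer.
  by move=> Yh; apply: Ye; apply: He => //; rewrite subUset sub1set sY andbT; apply/zsetP.
have [Z ZC [Zh Ze sZ]] := om_strong_elim XC YC Xh Yh Xe Ye.
apply: Ze; apply: He => //; rewrite subUset sub1set; apply/andP; split; first exact/zsetP.
by apply: subset_trans sZ; rewrite subsetI sX.
Qed.

Definition ind I := [forall e in I, e \notin clos (I :\ e)].

Lemma indP I : reflect (forall e, e \in I -> e \notin clos (I :\ e)) (ind I).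
Proof. exact: (iffP forall_inP). Qed.

Lemma ind_sub I J : I \subset J -> ind J -> ind I.
Proof.
move=> s /indP H; apply/indP => e eI; apply: contra (H e (subsetP s _ eI)).
by apply/subsetP/closS/setSD.
Qed.

Lemma indU1 I e : ind I -> e \notin clos I -> ind (e |: I).
Proof.
move=> /indP H ne; have eI : e \notin I by apply: contra ne; apply/subsetP/sub_clos.
apply/indP => x; rewrite in_setU1 => /orP[/eqP->|xI].
  by rewrite setU1K.
have nx : x != e by apply: contra eI => /eqP<-.
have -> : (e |: I) :\ x = e |: (I :\ x).
  by apply/setP => y; rewrite !inE; case: (altP (y =P e)) => // ->; rewrite eq_sym nx.
apply/negP => /(clos_exchange (H x xI)).
by rewrite setD1K // => eq; case/negP: ne.
Qed.

(** Steinitz exchange: an element of I outside A is traded for one of A, which shrinks [I :\: A]. *)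
Lemma ind_le I A : ind I -> I \subset clos A -> #|I| <= #|A|.
Proof.
have [n] := ubnP #|I :\: A|; elim: n I => // n IH I; rewrite ltnS => le indI sI.
case: (boolP (I \subset A)) => [/subset_leq_card //|/subsetPn [e eI eA]].
have ne := indP _ indI e eI.
have [s sA ns] : exists2 s, s \in A & s \notin clos (I :\ e).
  apply/subsetPn; apply: contra ne => /clos_min sA.
  by apply: (subsetP sA); apply: (subsetP sI).
have nse : s \notin I :\ e by apply: contra ns; apply/subsetP/sub_clos.
have -> : #|I| = #|s |: (I :\ e)| by rewrite cardsU1 nse [LHS](cardsD1 e) eI.
apply: IH.
- apply: leq_trans le; apply: proper_card; apply/properP; split.
    apply/subsetP => x; rewrite !inE => /andP[nx /orP[/eqP E|/andP[_ ->]]].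
      by rewrite E sA in nx.
    by rewrite nx.
  exists e; rewrite !inE ?eI ?eA //= eqxx /= orbF.
  by apply: contra eA => /eqP->.
- by apply: indU1 => //; apply: ind_sub indI; apply: subD1set.
rewrite subUset sub1set (subsetP (sub_clos A)) //=.
by apply: subset_trans sI; apply: subD1set.
Qed.

Lemma spanningP A : reflect (forall X, X \in C -> ~~ (A \subset zset X)) (spanning C A).
Proof.
apply: (iffP forall_inP) => H X XC; move: (H X XC); rewrite disjoints_subset;
  have -> : ~: supp X = zset X by apply/setP => h; rewrite !inE negbK.
all: by [].
Qed.

Lemma spanning_clos A : spanning C A -> clos A = setT.
Proof.
move/spanningP => H; apply/setP => e; rewrite in_setT; apply/closP => X XC s.
by move: (H X XC); rewrite s.
Qed.

Lemma indepE I : indep C I = ind I.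
Proof.
apply/existsP/idP => [[B /andP[/minsetP [spB minB] sIB]]|indI].
  apply: (ind_sub sIB); apply/indP => e eB; apply/negP => /closP He.
  have /setP/(_ e) : B :\ e = B.
    apply: minB; last exact: subD1set.
    apply/spanningP => X XC; apply/negP => s.
    case/negP: (spanningP _ spB X XC); apply/subzP => h hB.
    case: (altP (h =P e)) => [->|nh]; first exact: He.
    by move/subzP: s; apply; rewrite !inE nh.
  by rewrite !inE eqxx eB.
(* A maximal independent set above I is a minimal spanning set. *)
have [B /maxsetP [/andP[indB sIB] maxB] _] := @maxset_exists _ (fun B => ind B && (I \subset B)) I
  (introT andP (conj indI (subxx I))).
exists B; rewrite sIB andbT; apply/minsetP; split.
  apply/spanningP => X XC; apply/negP => s; have [e Xe] := om_nz XC.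
  have ne : e \notin clos B by apply/negP => /closP/(_ X XC s).
  have eB : e \in B.
    by rewrite -(maxB (e |: B)) ?setU11 ?subsetU1 // indU1 //= (subset_trans sIB) // subsetU1.
  by case/negP: ne; apply: (subsetP (sub_clos B)).
move=> B' spB' sB'; apply/eqP; rewrite eqEsubset sB' /=.
apply/subsetP => e eB; apply/negPn/negP => eB'.
have := indP _ indB e eB; rewrite -[_ \in _]negbK => /negPn; case/negP.
have : clos B' \subset clos (B :\ e).
  by apply: closS; apply/subsetP => x xB'; rewrite !inE (subsetP sB') // andbT;
     apply: contra eB' => /eqP<-.
by rewrite (spanning_clos spB') => /subsetP; apply; rewrite in_setT.
Qed.

Lemma mrank_ge I A : ind I -> I \subset A -> #|I| <= mrank C A.
Proof. by move=> iI sI; rewrite /mrank (leq_bigmax_cond) // sI indepE. Qed.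

Lemma mrank_ex A : exists I, [/\ ind I, I \subset A, A \subset clos I & #|I| = mrank C A].
Proof.
have : 0 < #|[pred I : {set T} | (I \subset A) && indep C I]|.
  apply/card_gt0P; exists set0; rewrite inE sub0set indepE.
  by apply/indP => e; rewrite inE.
case/(eq_bigmax_cond (fun I : {set T} => #|I|)) => I.
rewrite inE indepE => /andP[sI indI] E; exists I; split=> //.
apply/subsetP => e eA; apply/negPn/negP => ne.
have := @mrank_ge (e |: I) A (indU1 indI ne).
rewrite subUset sub1set eA sI => /(_ isT).
rewrite cardsU1 (contra _ ne); last by apply/subsetP/sub_clos.
by rewrite [mrank _ _]E add1n ltnn.
Qed.

(* [crk n A]: the flat spanned by [A] has corank at most [n]. *)
Fixpoint crk n A : Prop :=
  if n is m.+1 then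
    forall e X, X \in C -> A \subset zset X -> X e <> Zer -> crk m (e |: A)
  else forall X, X \in C -> ~~ (A \subset zset X).

Lemma crkP n A : crk n A <-> om_rank C <= mrank C A + n.
Proof.
have sp B : (forall X, X \in C -> ~~ (B \subset zset X)) -> om_rank C <= mrank C B.
  move=> spB; have [I [indI sI sB <-]] := mrank_ex B.
  have [J [indJ _ _ EJ]] := mrank_ex setT.
  rewrite /om_rank -EJ; apply: ind_le => //.
  apply: subset_trans (subsetT J) _; rewrite -(@spanning_clos I) //.
  apply/spanningP => X XC; apply: contra (spB X XC) => sX.
  by apply/subzP => e /(subsetP sB)/closP; apply.
elim: n A => [|n IH] A /=.
  rewrite addn0; split; first exact: sp.
  move=> le X XC; apply/negP => sX; have [e Xe] := om_nz XC.
  have [I [indI sI sA EI]] := mrank_ex A.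
  have ne : e \notin clos I.
    by apply/negP => /closP/(_ X XC (subset_trans sI sX)).
  have := mrank_ge (indU1 indI ne) (subsetT _).
  rewrite cardsU1 (contra _ ne); last by apply/subsetP/sub_clos.
  by rewrite EI add1n => lt; move: (leq_ltn_trans le lt); rewrite ltnn.
split=> [H|le e X XC sA Xe].
  case: (classic (forall X, X \in C -> ~~ (A \subset zset X))) => [/sp/leq_trans|N].
    by apply; apply: leq_addr.
  have [X [XC sA]] : exists X, X \in C /\ A \subset zset X.
    apply: NNPP => N'; apply: N => X XC; apply/negP => sA; apply: N'; by exists X.
  have [e Xe] := om_nz XC; have /IH := H e X XC sA Xe.
  move/leq_trans; apply; rewrite addnS -addSn leq_add2r.
  have [I [indI sI _ <-]] := mrank_ex (e |: A).
  apply: (@leq_trans #|I :\ e|.+1); first by rewrite (cardsD1 e I); case: (e \in I).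
  rewrite ltnS; apply: mrank_ge; first by apply: ind_sub indI; apply: subD1set.
  apply/subsetP => x; rewrite !inE => /andP[nx xI].
  by move/subsetP/(_ x xI): sI; rewrite !inE (negbTE nx).
apply/IH; apply: leq_trans le _; rewrite addnS -addSn leq_add2r.
have [I [indI sI _ <-]] := mrank_ex A.
have ne : e \notin clos I.
  by apply/negP => /closP/(_ X XC (subset_trans sI sA)).
rewrite -add1n -(_ : (e \notin I) = 1 :> nat).
  rewrite -cardsU1; apply: mrank_ge; first exact: indU1.
  by apply: setUS.
by rewrite (contra _ ne) //; apply/subsetP/sub_clos.
Qed.

Lemma crkW n A e : crk n (e |: A) -> crk n.+1 A.
Proof.
move/crkP => le; apply/crkP; apply: leq_trans le _; rewrite addnS -addSn leq_add2r.
have [I [indI sI _ <-]] := mrank_ex (e |: A).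
apply: (@leq_trans #|I :\ e|.+1); first by rewrite (cardsD1 e I); case: (e \in I).
rewrite ltnS; apply: mrank_ge; first by apply: ind_sub indI; apply: subD1set.
apply/subsetP => x; rewrite !inE => /andP[nx xI].
by move/subsetP/(_ x xI): sI; rewrite !inE (negbTE nx).
Qed.

Lemma crk_clos n A B : (forall X, X \in C -> A \subset zset X -> B \subset zset X) ->
  crk n B -> crk n A.
Proof.
elim: n A B => [|n IH] A B s /= H; first by move=> X XC; apply: contra (H X XC); apply: s.
move=> e X XC sA Xe; apply: IH (H e X XC (s X XC sA) Xe) => Y YC.
by rewrite !subUset => /andP[-> /(s Y YC)].
Qed.

Lemma crk1 A X Y : crk 1 A -> X \in C -> Y \in C -> A \subset zset X -> A \subset zset Y ->
  Y = X \/ Y = oppv X.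
Proof.
move=> cA XC YC sX sY; apply: om_incomp => //; apply/subsetP => h /zsetP Xh.
apply/zsetP; apply: NNPP => Yh; have := cA h Y YC sY Yh X XC.
by rewrite subUset sX andbT sub1set; move/zsetP.
Qed.

Lemma crk1_zset X : X \in C -> crk 1 (zset X).
Proof.
move=> XC e Y YC sY Ye Z ZC; apply/negP; rewrite subUset sub1set => /andP[/zsetP Ze sZ].
have [E|E] := om_incomp XC YC sY; have [F|F] := om_incomp XC ZC sZ; subst;
  move: Ye Ze; rewrite ?ffunE; by case: (X e).
Qed.

(** * Lines *)

Section Line.
Variables (A : {set T}) (lineA : crk 2 A).

Definition on X := (X \in C) && (A \subset zset X).

Lemma on_opp X : on (oppv X) = on X.
Proof. by rewrite /on om_oppE subz_opp. Qed.

(** An element that does not vanish on the whole line lowers the corank to one, hence cuts the line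
    in one point up to sign. *)
Lemma pt_uniq x P X Y : on P -> P x <> Zer -> on X -> on Y -> X x = Zer -> Y x = Zer ->
  Y = X \/ Y = oppv X.
Proof.
move=> /andP[PC sP] Px /andP[XC sX] /andP[YC sY] Xx Yx.
by apply: (crk1 (lineA PC sP Px)) => //; rewrite subUset sub1set ?sX ?sY andbT; apply/zsetP.
Qed.

(* Modular elimination is strong: two elements vanishing at a common point of a line are
   parallel there, so their signs cannot agree at [X] and disagree at [Y]. *)
Lemma line_elim X Y e : on X -> on Y -> X <> oppv Y -> X e <> Zer -> X e = sopp (Y e) ->
  exists Z, [/\ on Z, Z e = Zer & vsum X Y Z].
Proof.
move=> oX oY nXY Xe XYe; have /andP[XC /subzP sX] := oX; have /andP[YC /subzP sY] := oY.
case: OMC => _ _ _ H.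
case: (H X Y e XC YC nXY) => [|Z ZC [Ze Zp Zn]]; first by rewrite inE -XYe eqxx andbT; apply/eqP.
have oZ : on Z.
  rewrite /on ZC; apply/subzP => h hA; move: (Zp h) (Zn h); rewrite sX // sY //.
  case: (Z h) => //; first by case=> // /esym; case.
  by move=> _; case=> // /esym; case.
exists Z; split=> // h.
have Ye : Y e <> Zer by move=> E; move: XYe; rewrite E.
have par W : on W -> W e <> Zer -> Z h = Zer -> W h = Zer -> forall P, on P -> P h = Zer.
  move=> oW We Zh Wh P oP; apply: NNPP => Ph.
  have [E|E] := pt_uniq oP Ph oZ oW Zh Wh; apply: We; rewrite E ?ffunE Ze //.
have Zh0 : Z h = Zer -> X h = Zer -> Y h = Zer by move=> Zh Xh; apply: (par X).
have Zh1 : Z h = Zer -> Y h = Zer -> X h = Zer by move=> Zh Yh; apply: (par Y).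
(* Otherwise eliminating h between X and -Y gives Z or -Z again, and the two sets of sign conditions
   force Z to vanish wherever X does, or wherever Y does. Then Z is that point up to sign, which e
   forbids. *)
have Zh2 : Z h = Zer -> X h = Y h -> X h = Zer.
  move=> Zh XY; apply: NNPP => Xh.
  have nX : X <> oppv (oppv Y).
    by rewrite oppvK => E; move: Xe XYe; rewrite E; case: (Y e).
  case: (H X (oppv Y) h XC _ nX) => [||Z2 Z2C [Z2h Z2p Z2n]]; first by rewrite om_oppE.
    by rewrite inE oppvE soppK XY eqxx -XY andbT; apply/eqP.
  have oZ2 : on Z2.
    rewrite /on Z2C; apply/subzP => k kA; move: (Z2p k) (Z2n k); rewrite ffunE sX // sY //=.
    case: (Z2 k) => //; first by case=> // /esym; case.
    by move=> _; case=> // /esym; case.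
  have notsub W : on W -> W e <> Zer -> (forall k, W k = Zer -> Z k = Zer) -> False.
    move=> /andP[WC _] We s; have : zset W \subset zset Z.
      by apply/subsetP => k; rewrite !inE => /eqP/s/eqP.
    case/(om_incomp WC ZC) => E; move: Ze; rewrite E ?ffunE; move: We; by case: (W e).
  have [E|E] := pt_uniq oX Xh oZ oZ2 Zh Z2h.
    apply: (notsub X) => // k Xk; move: (Zp k) (Zn k) (Z2p k) (Z2n k); rewrite E ffunE Xk.
    by case: (Z k); case: (Y k) => //= a b c d; intuition congruence.
  apply: (notsub Y) => // k Yk; move: (Zp k) (Zn k) (Z2p k) (Z2n k); rewrite E !ffunE Yk.
  by case: (Z k); case: (X k) => //= a b c d; intuition congruence.
move: (Zp h) (Zn h) Zh0 Zh1 Zh2.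
by case: (X h); case: (Y h); case: (Z h) => //= a b c d f; intuition congruence.
Qed.

Lemma line_diff X Y g : on X -> on Y -> X <> Y -> X g <> Zer -> X g = Y g ->
  exists W, [/\ on W, W g = Zer & vsum X W Y].
Proof.
move=> oX oY n Xg XYg.
have [|||||W [oW Wg S]] := @line_elim (oppv X) Y g; rewrite ?on_opp //.
- by move=> E; apply: n; rewrite -[X]oppvK E oppvK.
- by rewrite ffunE; move: Xg; case: (X g).
- by rewrite ffunE XYg.
by exists W; split=> //; apply: vsum_oppl.
Qed.

Lemma line_meet X Y m : on X -> on Y -> Y <> X -> Y <> oppv X -> exists2 V, on V & V m = Zer.
Proof.
move=> oX oY n1 n2; case: (classic (X m = Zer)) => Xm; first by exists X.
case: (classic (Y m = Zer)) => Ym; first by exists Y.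
have [e|e] : X m = Y m \/ X m = sopp (Y m).
  by move: Xm Ym; case: (X m); case: (Y m); auto.
- by have [|W [oW Wm _]] := line_diff oX oY _ Xm e; [move=> E; apply: n1|exists W].
have [|W [oW Wm _]] := line_elim oX oY _ Xm e; last by exists W.
by move=> E; apply: n2; rewrite E oppvK.
Qed.

(** The difference of X and Y at x = 0 is P up to sign, so it does not change the sign at y
    either. *)
Lemma line_par P x y X Y : on P -> P x = Zer -> P y = Zer -> on X -> on Y ->
  X x <> Zer -> X x = Y x -> X y = Y y.
Proof.
move=> oP Px Py oX oY Xx XYx; case: (classic (X = Y)) => [->//|n].
have [W [oW Wx S]] := line_diff oX oY n Xx XYx.
have [E|E] := pt_uniq oX Xx oP oW Px Wx; move: (S y); rewrite E ?ffunE Py; sgn_solve.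
Qed.

Lemma line_par_opp P x y X Y : on P -> P x = Zer -> P y = Zer -> on X -> on Y ->
  X x <> Zer -> X x = sopp (Y x) -> X y = sopp (Y y).
Proof.
move=> oP Px Py oX oY Xx XYx.
by rewrite -oppvE; apply: (line_par oP Px Py); rewrite ?on_opp // oppvE.
Qed.

Lemma line_par0 P x y X : on P -> P x = Zer -> P y = Zer -> on X -> X x <> Zer -> X y = Zer ->
  forall Y, on Y -> Y y = Zer.
Proof.
move=> oP Px Py oX Xx Xy Y oY; apply: NNPP => Yy.
by have [E|E] := pt_uniq oY Yy oP oX Py Xy; apply: Xx; rewrite E ?ffunE Px.
Qed.

(** Compares the order by f/g with the order by its inverse g/f. At an element k that vanishes at X
    only, U and V both agree with Y; eliminating k between U and -V gives X up to sign, and its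
    entries at g and f relate V_g to U_f. *)
Lemma line_swap X Y U V g f : on X -> on Y -> on U -> on V ->
  X g <> Zer -> X g = Y g -> X f <> Zer -> X f = Y f ->
  vsum X U Y -> U g = Zer -> vsum X V Y -> V f = Zer ->
  V g = sopp (smul (smul (X f) (X g)) (U f)).
Proof.
move=> oX oY oU oV Xg XYg Xf XYf SU Ug SV Vf.
case: (classic (U f = Zer)) => Uf.
  by have [E|E] := pt_uniq oX Xf oU oV Uf Vf; rewrite E ?ffunE Ug Uf; case: (X f); case: (X g).
have [k [Xk Yk]] : exists k, X k = Zer /\ Y k <> Zer.
  apply: NNPP => N; have s : zset X \subset zset Y.
    apply/subsetP => k; rewrite !inE => /eqP Xk; apply/eqP; apply: NNPP => Yk.
    by apply: N; exists k.
  have /andP[XC _] := oX; have /andP[YC _] := oY.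
  have /andP[UC _] := oU.
  have s' : zset X \subset zset U.
    apply/subsetP => k; have := subsetP s k; rewrite !inE => Yk /eqP Xk.
    by move: (SU k) Yk; rewrite Xk => -> ->; rewrite ?Xk.
  by have [E|E] := om_incomp XC UC s'; apply: Xg; move: Ug; rewrite E ?ffunE; case: (X g).
have Uk : U k = Y k by move: (SU k); rewrite Xk.
have Vk : V k = Y k by move: (SV k); rewrite Xk.
have [M [oM Mk SM]] : exists M, [/\ on M, M k = Zer & vsum U (oppv V) M].
  apply: line_elim; rewrite ?on_opp ?oppvK ?oppvE ?soppK ?Uk ?Vk //.
  by move=> E; apply: Uf; rewrite E.
have [E|E] := pt_uniq oY Yk oX oM Xk Mk; move: (SM g) (SM f); rewrite E ?ffunE Ug Vf; sgn_solve.
Qed.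

End Line.

Lemma on_sub A B X : A \subset B -> on B X -> on A X.
Proof. by move=> s /andP[XC sX]; rewrite /on XC (subset_trans s). Qed.

End Rank.

(** * Comparison of integers and of integer sequences; [Pos] stands for an increase *)

Definition zcmp (x y : Z) : sgn :=
  match (x ?= y)%Z with Lt => Pos | Eq => Zer | Gt => Neg end.

Arguments zcmp : simpl never.

Definition zscale (c : sgn) (x : Z) : Z :=
  match c with Pos => x | Neg => (- x)%Z | Zer => 0%Z end.

Arguments zscale !c x /.

Lemma zcmpP x y : match zcmp x y with
  Pos => (x < y)%Z | Zer => x = y | Neg => (y < x)%Z end.
Proof. by rewrite /zcmp; case: Z.compare_spec. Qed.

Ltac zcmp_solve :=
  repeat match goal with
  | |- context [zcmp ?x ?y] => move: (zcmpP x y); case: (zcmp x y)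
  end;
  simpl in *; intros; try discriminate; try congruence; try (exfalso; lia); try lia; auto.

Lemma zcmp_scale c x y : zcmp (zscale c x) (zscale c y) = smul c (zcmp x y).
Proof. by case: c => /=; zcmp_solve. Qed.

Lemma zcmp0_scale c x : zcmp 0 (zscale c x) = smul c (zcmp 0 x).
Proof. by case: c => /=; zcmp_solve. Qed.

Lemma zcmp_opp x y : zcmp (- x) (- y) = sopp (zcmp x y).
Proof. by zcmp_solve. Qed.

Lemma zcmpC x y : zcmp y x = sopp (zcmp x y).
Proof. by zcmp_solve. Qed.

Lemma zcmpxx x : zcmp x x = Zer.
Proof. by zcmp_solve. Qed.

Lemma zcmp0 x y : zcmp x y = Zer -> x = y.
Proof. by zcmp_solve. Qed.

Lemma zcmp_trans x y z s : zcmp x y = s -> zcmp y z = s -> zcmp x z = s.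
Proof. by move=> <-; zcmp_solve. Qed.

Definition sthen (s t : sgn) : sgn := if s is Zer then t else s.

Fixpoint lcmp (s t : seq Z) : sgn :=
  match s, t with
  | x :: s', y :: t' => sthen (zcmp x y) (lcmp s' t')
  | _, _ => Zer
  end.

Lemma lcmp_cons x y s t : lcmp (x :: s) (y :: t) = sthen (zcmp x y) (lcmp s t).
Proof. by []. Qed.

Lemma lcmpxx s : lcmp s s = Zer.
Proof. by elim: s => //= x s ->; rewrite zcmpxx. Qed.

Lemma lcmpC s t : lcmp t s = sopp (lcmp s t).
Proof.
elim: s t => [|x s IH] [|y t] //=; rewrite zcmpC IH.
by case: (zcmp x y).
Qed.

Lemma lcmp0 s t : size s = size t -> lcmp s t = Zer -> s = t.
Proof.
elim: s t => [|x s IH] [|y t] //= [sz].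
by case E: (zcmp x y) => // /IH ->; rewrite // (zcmp0 E).
Qed.

Lemma lcmp_scale c s t : lcmp (map (zscale c) s) (map (zscale c) t) = smul c (lcmp s t).
Proof.
elim: s t => [|x s IH] [|y t] /=; try by case: (c).
by rewrite zcmp_scale IH; case: (zcmp x y); case: (c).
Qed.

Lemma lcmp_cat s1 s2 t1 t2 : size s1 = size t1 ->
  lcmp (s1 ++ s2) (t1 ++ t2) = sthen (lcmp s1 t1) (lcmp s2 t2).
Proof.
elim: s1 t1 => [|x s IH] [|y t] //= [sz].
by rewrite IH //; case: (zcmp x y).
Qed.

Lemma lcmp_trans s t u : size s = size t -> size t = size u ->
  lcmp s t <> Neg -> lcmp t u <> Neg ->
  lcmp s u <> Neg /\ (lcmp s u = Zer -> lcmp s t = Zer /\ lcmp t u = Zer).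
Proof.
elim: s t u => [|x s IH] [|y t] [|z u] //= [sz1] [sz2].
move: (IH t u sz1 sz2); case: (lcmp s t) (lcmp t u) (lcmp s u) => [] [] []; zcmp_solve; intuition congruence.
Qed.

(** The leading term of a lexicographic number, padded with zeros to keep the length. *)
Fixpoint first_nz (s : seq Z) : seq Z :=
  if s is x :: s' then
    if (x =? 0)%Z then x :: first_nz s' else x :: nseq (size s') 0%Z
  else [::].

Lemma size_first_nz s : size (first_nz s) = size s.
Proof. by elim: s => //= x s IH; case: ifP => /=; rewrite ?IH // size_nseq. Qed.

(** Truncation after the leading entry may create a tie but never reverses an order. *)
Lemma lcmp_first_nz s t : size s = size t ->
  lcmp (first_nz s) (first_nz t) = Zer \/ lcmp (first_nz s) (first_nz t) = lcmp s t.
Proof.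
elim: s t => [|x s IH] [|y t] //=; first by left.
case=> sz.
case: Z.eqb_spec => x0; case: Z.eqb_spec => y0 /=.
- by rewrite x0 y0 zcmpxx; apply: IH.
- by subst x; move: (zcmpP 0 y); case: (zcmp 0 y) => // E; try (by right); congruence.
- by subst y; move: (zcmpP x 0); case: (zcmp x 0) => // E; try (by right); congruence.
case: (zcmp x y); try by right.
by left; rewrite sz lcmpxx.
Qed.

Lemma first_nz_cat s x u v : x <> 0%Z -> size u = size v ->
  first_nz (s ++ x :: u) = first_nz (s ++ x :: v).
Proof.
move=> x0 sz; elim: s => [|y s IH] /=; last by rewrite IH !size_cat /= sz.
by case: Z.eqb_spec => // _; rewrite sz.
Qed.

Definition asbool (P : Prop) : bool := if excluded_middle_informative P then true else false.
Lemma asboolP (P : Prop) : reflect P (asbool P).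
Proof. by rewrite /asbool; case: excluded_middle_informative => p; constructor. Qed.

(** * Potentials *)

Section Potential.
Variables (T : finType) (C : {set signvec T}).
Hypothesis OMC : is_OM C.
Implicit Types (X Y Z W : signvec T) (A B I J : {set T}) (g f : T).

Lemma crkS n A B : A \subset B -> crk C n A -> crk C n B.
Proof. by move=> s; apply: crk_clos => X _; apply: subset_trans. Qed.

Lemma comodular_line A X Y : crk C 2 A -> on C A X -> on C A Y -> X <> Y -> X <> oppv Y ->
  comodular C X Y.
Proof.
move=> lA /andP[XC sX] /andP[YC sY] n1 n2; split=> //; split.
  exists [:: X; Y]; rewrite /= ?XC ?YC //.
  by apply/ffunP => h; rewrite !ffunE; case: (X h); case: (Y h).
rewrite zset_compose; apply/eqP; rewrite eqn_leq; apply/andP; split; last first.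
  by apply/(crkP OMC); apply: crkS lA; rewrite subsetI sX.
rewrite leqNgt addn2 ltnS -addn1; apply/negP => /(crkP OMC) c1.
have [||E|E] := crk1 OMC c1 XC YC; rewrite ?subsetIl ?subsetIr //; first exact: n1.
by apply: n2; rewrite E oppvK.
Qed.

Lemma line_comodular X Y : comodular C X Y -> crk C 2 (zset X :&: zset Y).
Proof. by case=> _ _ _ _ [_ E]; apply/(crkP OMC); rewrite -E zset_compose. Qed.

(** W would vanish wherever X does, hence equal X up to sign, against g. *)
Lemma vsum_self X W g : X \in C -> W \in C -> X g <> Zer -> W g = Zer -> ~ vsum X W X.
Proof.
move=> XC WC Xg Wg S; have s : zset X \subset zset W.
  apply/subsetP => k; rewrite !inE => /eqP Xk; by move: (S k); rewrite Xk => <-.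
by have [E|E] := om_incomp OMC XC WC s; apply: Xg; move: Wg; rewrite E ?ffunE; case: (X g).
Qed.

Section Cycle.
Variables (g f : T).

Lemma arrow_of_sum A X Y W : crk C 2 A -> on C A X -> on C A Y -> on C A W ->
  X g = Pos -> Y g = Pos -> W g = Zer -> conformal X Y -> vsum X W Y ->
  cg_edge C g X Y /\ arrow_sign C g f X Y (W f).
Proof.
move=> lA oX oY oW Xg Yg Wg cXY S; have [/andP[XC _] /andP[YC _] /andP[WC _]] := And3 oX oY oW.
split; last by exists W => //; apply/elim_resultP.
split=> //; apply: (comodular_line lA) => // E.
  by rewrite E in Xg S; apply: (vsum_self YC WC _ Wg S); rewrite Yg.
by move: Xg; rewrite E ffunE Yg.
Qed.

(** The height counts the vectors from which X can be reached along directed and undirected edges;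
    without directed cycles it grows strictly along a strict arrow. The upper bound serves to shift
    heights later. *)
Lemma euclid_rank : euclidean_program C g f ->
  exists h : signvec T -> Z, (forall X, 0 <= h X <= Z.of_nat #|signvec T|)%Z /\
   forall A X Y W, crk C 2 A -> on C A X -> on C A Y -> on C A W ->
    X g = Pos -> Y g = Pos -> W g = Zer -> conformal X Y -> vsum X W Y ->
    zcmp (h X) (h Y) = W f.
Proof.
move=> E; pose e := [rel X Y | asbool (cg_to C g f X Y \/ cg_both C g f X Y)].
have nocyc X Y : cg_to C g f X Y -> ~~ connect e Y X.
  move=> XY; apply/negP => /connectP [p0 pp0 lp0]; apply: E.
  case/shortenP: pp0 lp0 => p pp up _ lp.
  have nthS i : i < (size p).+1 -> nth (zerov T) (Y :: p) (i.+1 %% (size p).+1) =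
       if i == size p then Y else nth (zerov T) p i.
    rewrite ltnS leq_eqVlt; case: (altP (i =P size p)) => [->|_ /=]; first by rewrite modnn.
    by move=> lt; rewrite modn_small.
  have last_p : nth (zerov T) (Y :: p) (size p) = X by rewrite nth_last lp.
  (* The arrow that closes the cycle, from the last entry X back to Y, is the strict one. *)
  exists (Y :: p); split=> //.
    move=> i lt; rewrite nthS //; case: ifP => [/eqP->|ni].
      by rewrite last_p; left.
    have lt' : i < size p by move: lt; rewrite /= ltnS leq_eqVlt ni.
    by move/(pathP (zerov T))/(_ i lt')/asboolP: pp.
  by exists (size p) => //; rewrite nthS // eqxx last_p.
pose S X := [set Z | connect e Z X].
have SS X Y : e X Y -> S X \subset S Y.
  by move=> eXY; apply/subsetP => Z; rewrite !inE => /connect_trans; apply; apply: connect1.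
have to X Y : cg_to C g f X Y -> (Z.of_nat #|S X| < Z.of_nat #|S Y|)%Z.
  move=> XY; apply/Nat2Z.inj_lt/ltP/proper_card/properP; split.
    by apply: SS; apply/asboolP; left.
  by exists Y; rewrite inE ?connect0 // nocyc.
have both X Y : cg_both C g f X Y -> #|S X| <= #|S Y|.
  by move=> XY; apply/subset_leq_card/SS/asboolP; right.
exists (fun X => Z.of_nat #|S X|); split=> [X|A X Y W lA oX oY oW Xg Yg Wg cXY SW].
  by split; [apply: Nat2Z.is_nonneg | apply/Nat2Z.inj_le/leP; apply: max_card].
have [eXY aXY] := arrow_of_sum lA oX oY oW Xg Yg Wg cXY SW.
have [|||eYX aYX] := arrow_of_sum (W := oppv W) lA oY oX _ Yg Xg _ _ (vsum_oppr SW).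
- by rewrite on_opp.
- by rewrite ffunE Wg.
- apply/setP => h; move/setP/(_ h): cXY; rewrite !inE.
  by case: (X h); case: (Y h).
move: aXY aYX; rewrite ffunE; case: (W f) => /= aXY aYX.
- by have := to _ _ (conj eXY aXY); zcmp_solve.
- by have := to _ _ (conj eYX aYX); zcmp_solve.
have /leP/Nat2Z.inj_le le1 := both _ _ (conj eXY aXY).
have /leP/Nat2Z.inj_le le2 := both _ _ (conj eYX aYX).
by zcmp_solve.
Qed.

End Cycle.

(* [h] refines the value [X f / |X g|] of the points off [g], its sign included. *)
Definition potential g f (h : signvec T -> Z) :=
  (forall X, X g <> Zer -> zcmp 0 (h X) = X f) /\
  forall A X Y W, crk C 2 A -> on C A X -> on C A Y -> on C A W ->
    X g <> Zer -> X g = Y g -> W g = Zer -> vsum X W Y -> zcmp (h X) (h Y) = W f.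

(** Being Euclidean says nothing about such pairs, but there a constant height will do. In the main
    case f is a coloop: only one cocircuit up to sign sees f, it vanishes at g, and so X and Y both
    vanish at f. *)
Lemma euclid_sum_const g f : ~ is_program C g f ->
  forall X Y W, X \in C -> Y \in C -> W \in C ->
    X g <> Zer -> X g = Y g -> W g = Zer -> vsum X W Y -> W f = Zer.
Proof.
move=> nP X Y W XC YC WC Xg XYg Wg S; apply: NNPP => Wf; apply: nP; split.
- by move=> E; apply: Wf; rewrite -E.
- by move/(_ X XC).
case=> V VC sV; have Vh h : V h <> Zer -> h = f.
  by move=> E; apply/set1P; rewrite -sV inE; apply/eqP.
have Vf : V f <> Zer by apply/eqP; move/setP/(_ f): sV; rewrite !inE eqxx.
have only W' : W' \in C -> W' f <> Zer -> W' = V \/ W' = oppv V.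
  move=> W'C W'f.
  have s : zset W' \subset zset V.
    apply/subsetP => k; rewrite !inE => /eqP W'k; apply/eqP; apply: NNPP => /Vh E.
    by apply: W'f; rewrite -E.
  by have [->|->] := om_incomp OMC W'C VC s; rewrite ?oppvK; [left|right].
have Vg : V g = Zer.
  apply: NNPP => /Vh E; apply: Wf; by rewrite -E.
have nf X' : X' \in C -> X' g <> Zer -> X' f = Zer.
  move=> X'C X'g; apply: NNPP => /(only _ X'C) [E|E]; apply: X'g; by rewrite E ?ffunE Vg.
move: (S f); rewrite nf // (nf Y) // -?XYg // => /= E; apply: Wf.
by rewrite E.
Qed.

Lemma euclid_potential g f : euclidean_OM C -> exists h, potential g f h.
Proof.
move=> EC.
have [h0 [N [h0N Ph0]]] : exists h N, (forall X, 0 <= h X <= N)%Z /\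
   forall A X Y W, crk C 2 A -> on C A X -> on C A Y -> on C A W ->
    X g = Pos -> Y g = Pos -> W g = Zer -> vsum X W Y -> zcmp (h X) (h Y) = W f.
  case: (classic (is_program C g f)) => [/EC Efg|nP]; last first.
    exists (fun=> 0%Z), 0%Z; split=> [X|A X Y W lA]; first lia.
    move=> /andP[XC _] /andP[YC _] /andP[WC _] Xg Yg Wg S.
    by rewrite zcmpxx (euclid_sum_const nP XC YC WC _ _ Wg S) ?Xg ?Yg.
  have [h [hN Ph]] := euclid_rank Efg; exists h; eexists; split; first exact: hN.
  (* Arrows exist for conformal pairs only. Otherwise eliminating a separating k gives a point V
     between X and Y, and the steps from X to V and from V to Y have the same point W at
     infinity. *)
  move=> A X Y; have [n] := ubnP #|sep X Y|; elim: n X Y => // n IH X Y.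
  rewrite ltnS => le W lA oX oY oW Xg Yg Wg S.
  case: (set_0Vmem (sep X Y)) => [cXY|[k]]; first exact: (Ph A).
  rewrite inE => /andP[/eqP Xk /eqP XYk].
  have nXY : X <> oppv Y by move=> E; move: Xg; rewrite E ffunE Yg.
  have [V [oV Vk SV]] := line_elim OMC lA oX oY nXY Xk XYk.
  have Vg : V g = Pos by move: (SV g); rewrite Xg Yg.
  have Yk : Y k <> Zer by move=> E; apply: Xk; rewrite XYk E.
  have sub1 : #|sep X V| < n.
    apply: leq_trans le; apply/proper_card/properP; split.
      by apply/subsetP => h'; rewrite !inE; move: (SV h'); case: (X h'); case: (Y h'); case: (V h').
    by exists k; rewrite inE ?Vk ?XYk ?eqxx ?andbF //= ?soppK; move: Yk; case: (Y k).
  have sub2 : #|sep V Y| < n.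
    apply: leq_trans le; apply/proper_card/properP; split.
      by apply/subsetP => h'; rewrite !inE; move: (SV h'); case: (X h'); case: (Y h'); case: (V h').
    by exists k; rewrite inE ?Vk ?XYk ?eqxx ?andbF //= ?soppK; move: Yk; case: (Y k).
  have Wk : W k = Y k by move: (S k); rewrite XYk; move: Yk; case: (Y k); case: (W k).
  have same W' : on C A W' -> W' g = Zer -> W' k = Y k -> W' = W.
    move=> oW' W'g W'k; have Xg' : X g <> Zer by rewrite Xg.
    have [//|E] := pt_uniq OMC lA oX Xg' oW oW' Wg W'g.
    by move: W'k; rewrite E ffunE Wk; move: Yk; case: (Y k).
  have [|||W1 [oW1 W1g S1]] := @line_diff _ _ OMC _ lA X V g oX oV; rewrite ?Xg ?Vg //.
    by move=> E; apply: Xk; rewrite E.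
  have [|||W2 [oW2 W2g S2]] := @line_diff _ _ OMC _ lA V Y g oV oY; rewrite ?Yg ?Vg //.
    by move=> E; apply: Yk; rewrite -E.
  have E1 : W1 = W by apply: same => //; move: (S1 k); rewrite Vk XYk; sgn_solve.
  have E2 : W2 = W by apply: same => //; move: (S2 k); rewrite Vk; sgn_solve.
  rewrite E1 in S1; rewrite E2 in S2.
  apply: zcmp_trans (IH X V sub1 W _ _ _ _ _ _ _ S1) (IH V Y sub2 W _ _ _ _ _ _ _ S2) => //.
(* [h0] ranges over [0, N], so a shift by N + 1 puts the three signs of X_f in order and keeps the
   order within [Pos] and within [Neg]. Collapsing [Zer] to 0 is harmless: between two points with f
   = 0 the difference has f = 0. *)
pose h1 X := match X f with Zer => 0 | Pos => N + 1 + h0 X | Neg => h0 X - N - 1 end%Z.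
have s1 X : zcmp 0 (h1 X) = X f.
  by rewrite /h1; have := h0N X; case: (X f); zcmp_solve.
have Ph1 A X Y W : crk C 2 A -> on C A X -> on C A Y -> on C A W ->
    X g = Pos -> Y g = Pos -> W g = Zer -> vsum X W Y -> zcmp (h1 X) (h1 Y) = W f.
  move=> lA oX oY oW Xg Yg Wg S; have := Ph0 A X Y W lA oX oY oW Xg Yg Wg S.
  have := h0N X; have := h0N Y; move: (S f); rewrite /h1.
  by case: (X f); case: (Y f); case: (W f); zcmp_solve.
(* Odd extension to the side g < 0, since X_f / |X_g| changes sign with X. *)
exists (fun X => if X g is Neg then (- h1 (oppv X))%Z else h1 X); split=> [X Xg|].
  have := s1 (oppv X); rewrite ffunE; case: (X g) => //.
  by case: (X f) => /=; zcmp_solve.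
move=> A X Y W lA oX oY oW Xg XYg Wg S; rewrite -XYg; case E: (X g).
- by apply: (Ph1 A); rewrite -?XYg ?E.
2: by rewrite E in Xg.
rewrite zcmp_opp (Ph1 A _ _ (oppv W)) ?on_opp // ?ffunE ?soppK ?Wg ?E -?XYg ?E //.
exact: vsum_opp.
Qed.

Lemma no_directed_cycle g f (K : signvec T -> seq Z) n : (forall X, size (K X) = n) ->
  (forall X Y W, cg_edge C g X Y -> W \in C -> W g = Zer -> vsum X W Y ->
     lcmp (K X) (K Y) = W f) ->
  euclidean_program C g f.
Proof.
move=> szK HK [s [snil us Hs [i0 lt0 H0]]].
have step X Y r : cg_edge C g X Y -> arrow_sign C g f X Y r -> lcmp (K X) (K Y) = r.
  by move=> eXY [W /elim_resultP [WC Wg SW] <-]; apply: HK.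
have s0 : 0 < size s by case: (s) snil.
(* The cycle is read from its strict arrow on, so all later keys stay strictly above the first one,
   including the key met after a full turn. *)
pose a j := K (nth (zerov T) s ((i0 + j) %% size s)).
have aS j : a j.+1 = K (nth (zerov T) s (((i0 + j) %% size s).+1 %% size s)).
  by rewrite /a addnS -[in RHS]addn1 modnDml addn1.
have pos j : lcmp (a 0) (a j.+1) = Pos.
  elim: j => [|j IH].
    rewrite aS /a addn0 (modn_small lt0); case: H0; exact: step.
  have st : lcmp (a j.+1) (a j.+2) <> Neg.
    rewrite [a j.+2]aS; case: (Hs _ (ltn_pmod (i0 + j.+1) s0)) => -[e ar]; by rewrite (step _ _ _ e ar).
  have [||||] := @lcmp_trans (a 0) (a j.+1) (a j.+2); rewrite ?szK //; first by rewrite IH.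
  by rewrite IH; case: (lcmp (a 0) _) => // _ [].
have := pos (size s).-1; rewrite prednK // /a modnDr addn0 lcmpxx; by [].
Qed.

End Potential.

(** * Points infinitely near the cocircuits of the deletion *)

Fixpoint lsign (T : finType) (l : seq (T * sgn)) (X : signvec T) : sgn :=
  if l is (e, al) :: l' then if X e is Zer then lsign l' X else smul al (X e) else Zer.

Section Lexicographic.
Variables (T : finType) (D : {set signvec T}) (p : T) (es : seq (T * sgn)).
Hypothesis OMD : is_OM D.
Hypothesis no_coloop : forall X, X \in D -> exists2 k, k <> p & X k <> Zer.
Hypothesis esP : forall e, e \in es -> e.1 <> p /\ e.2 <> Zer.
Implicit Types (X Y Z W U V : signvec T) (A B : {set T}) (a g f h m : T) (al s : sgn).

(* The cocircuits of the deletion of [p], identified with their extensions in [D]. *)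
Definition old X := (X \in D) &&
  [forall Z in D, (zset X :\ p \subset zset Z) ==> ((Z == X) || (Z == oppv X))].

Hypothesis old_sign : forall X, old X -> X p = lsign es X.

Lemma oldP X : reflect (X \in D /\ forall Z, Z \in D -> zset X :\ p \subset zset Z ->
  Z = X \/ Z = oppv X) (old X).
Proof.
apply: (iffP andP) => -[XD H]; split=> //.
  move=> Z ZD sZ; move/forall_inP/(_ Z ZD)/implyP/(_ sZ): H.
  by case/orP => /eqP; [left|right].
apply/forall_inP => Z ZD; apply/implyP => /(H Z ZD) [->|->]; by rewrite eqxx ?orbT.
Qed.

Lemma oldD X : old X -> X \in D. Proof. by case/oldP. Qed.

Lemma zset_opp X : zset (oppv X) = zset X.
Proof. by apply/setP => h; rewrite !inE ffunE; case: (X h). Qed.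

Lemma old_opp X : old (oppv X) = old X.
Proof.
apply/oldP/oldP => -[XD H]; split; rewrite ?om_oppE // ?zset_opp in XD H * => //.
all: by move=> Z ZD /(H Z ZD) []; rewrite ?oppvK; auto.
Qed.

Lemma on0 A X h : on D A X -> h \in A -> X h = Zer.
Proof. by case/andP => _ /subzP; apply. Qed.

Lemma onU1 A X h : on D A X -> X h = Zer -> on D (h |: A) X.
Proof. by rewrite /on subUset sub1set => /andP[-> ->] Xh; rewrite andbT; apply/zsetP. Qed.

Lemma onD A X : on D A X -> X \in D. Proof. by case/andP. Qed.

(** X is chosen with the largest zero set off p among the candidates that see e. *)
Lemma delete_old Z e : Z \in D -> e <> p -> Z e <> Zer ->
  exists X, [/\ old X, X e <> Zer & zset Z :\ p \subset zset X].
Proof.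
move=> ZD ep Ze; pose P X := [&& X \in D, X e != Zer & zset Z :\ p \subset zset X].
have PZ : P Z by rewrite /P ZD subD1set andbT; apply/eqP.
case: (arg_maxnP (fun X => #|zset X :\ p|) PZ) => X /and3P [XD /eqP Xe sZX] maxX.
exists X; split=> //; apply/oldP; split=> // Y YD sXY.
have sXY' : zset X :\ p \subset zset Y :\ p.
  by apply/subsetP => k kX; rewrite in_setD1 (subsetP sXY) // andbT; move: kX; rewrite !inE => /andP[].
case: (classic (Y e = Zer)) => Ye.
  have [k kp Yk] := no_coloop YD.
  have Xk : X k <> Zer.
    by move=> Xk; apply: Yk; move/subzP: sXY; apply; rewrite !inE Xk eqxx andbT; apply/eqP.
  (* V still sees e and vanishes at k in addition to the zeros of X off p, against maximality. *)
  have [V VD [Vk Ve sV]] := om_strong_elim OMD YD XD Yk Xk Ye Xe.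
  have sXV : zset X :\ p \subset zset V.
    apply: subset_trans sV; rewrite subsetI sXY; exact: subD1set.
  have /maxX : P V.
    rewrite /P VD /=; apply/andP; split; first exact/eqP.
    apply: subset_trans sXV; apply/subsetP => q qZ; rewrite in_setD1 (subsetP sZX) // andbT.
    by move: qZ; rewrite !inE => /andP[].
  rewrite /= leqNgt => /negP; case; apply: proper_card; apply/properP; split.
    apply/subsetP => q qX; rewrite in_setD1 (subsetP sXV) // andbT.
    by move: qX; rewrite !inE => /andP[].
  exists k; rewrite !inE ?Vk ?eqxx ?andbT; first exact/eqP.
  by rewrite negb_and; apply/orP; right; apply/eqP.
have /maxX : P Y.
  rewrite /P YD /=; apply/andP; split; first exact/eqP.
  apply: subset_trans sXY; apply/subsetP => q qZ; rewrite in_setD1 (subsetP sZX) // andbT.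
  by move: qZ; rewrite !inE => /andP[].
rewrite /= => leYX; have EYX : zset X :\ p = zset Y :\ p.
  by apply/eqP; rewrite eqEcard sXY'.
have cmp V W : zset V :\ p = zset W :\ p -> (W p = Zer \/ V p <> Zer) -> zset V \subset zset W.
  move=> E nor; apply/subsetP => q; case: (altP (q =P p)) => [->|qp].
    by rewrite !inE; case: nor => [->//|]; case: (V p).
  by move/setP/(_ q): E; rewrite !in_setD1 qp /= => ->.
case: (classic (Y p = Zer \/ X p <> Zer)) => [nor|N].
  by apply: (om_incomp OMD XD YD); apply: cmp nor.
have [|E|E] := om_incomp OMD YD XD; first (apply: cmp => //; right => Yp; apply: N; by left).
  by left.
by right; rewrite E oppvK.
Qed.

(** A hyperplane spanned by elements other than p is already a hyperplane of the deletion. *)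
Lemma old_pt A W : p \notin A -> crk D 1 A -> on D A W -> old W.
Proof.
move=> pA cA /andP[WD sW]; have [k kp Wk] := no_coloop WD.
have [X [oX Xk sX]] := delete_old WD kp Wk.
have sAX : A \subset zset X.
  apply: subset_trans sX; apply/subsetP => q qA; rewrite in_setD1 (subsetP sW) // andbT.
  by apply: contraNN pA => /eqP<-.
by have [E|E] := crk1 OMD cA WD (oldD oX) sW sAX; move: oX; rewrite E ?old_opp.
Qed.

Lemma lsign_split l1 a al l2 X : es = l1 ++ (a, al) :: l2 ->
  (forall e, e \in l1 -> X e.1 = Zer) -> X a <> Zer -> lsign es X = smul al (X a).
Proof.
move=> ->; elim: l1 => [|[e be] l IH] /= H Xa; first by case: (X a) Xa.
by rewrite (H (e, be)) ?mem_head //; apply: IH => // e' l'; apply: H; rewrite inE l' orbT.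
Qed.

Lemma lsign0 X : (forall e, e \in es -> X e.1 = Zer) -> lsign es X = Zer.
Proof.
elim: (es) => [//|[e be] l IH] /= H; rewrite (H (e, be)) ?mem_head //; apply: IH => e' l'.
by apply: H; rewrite inE l' orbT.
Qed.

Definition lead X l1 a al l2 := [/\ es = l1 ++ (a, al) :: l2,
   (forall e, e \in l1 -> X e.1 = Zer) & X a <> Zer].

Lemma lead_ex X : (exists2 e, e \in es & X e.1 <> Zer) -> exists l1 a al l2, lead X l1 a al l2.
Proof.
rewrite /lead; elim: (es) => [[e] //|[a al] l IH] [e].
case: (classic (X a = Zer)) => Xa; last by exists [::], a, al, l; split.
rewrite inE => /orP[/eqP-> //|el Xe].
have [l1 [b [be [l2 [E H Xb]]]]] := IH (ex_intro2 _ _ e el Xe).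
exists ((a, al) :: l1), b, be, l2; split; rewrite ?E // => e'.
by rewrite inE => /orP[/eqP->|/H].
Qed.

Lemma lead_uniq X l1 a al l2 k1 b be k2 :
  lead X l1 a al l2 -> lead X k1 b be k2 -> l1 = k1 /\ (a, al, l2) = (b, be, k2).
Proof.
rewrite /lead; elim: l1 (es) k1 => [|x l1 IH] s [|y k1] [E1 H1 Xa] [E2 H2 Xb];
  rewrite E1 in E2; case: E2.
- by move=> -> -> ->.
- by move=> E _; case: Xa; rewrite -(H2 y) ?mem_head // -E.
- by move=> E _; case: Xb; rewrite -(H1 x) ?mem_head // E.
move=> <- E; have [||<- ->] // := IH (l1 ++ (a, al) :: l2) k1.
  by split=> // e el; apply: H1; rewrite inE el orbT.
by split=> // e el; apply: H2; rewrite inE el orbT.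
Qed.

Lemma leadP X l1 a al l2 : lead X l1 a al l2 ->
  [/\ a <> p, al <> Zer & forall e, e \in l1 -> e.1 <> p].
Proof.
case=> E _ _; have mem e : e \in l1 ++ (a, al) :: l2 -> e \in es by rewrite E.
have [] := esP (mem (a, al) _); first by rewrite mem_cat mem_head orbT.
move=> ap al0; split=> // e el; by have [] := esP (mem e _); rewrite ?mem_cat ?el.
Qed.

Lemma old_lead X l1 a al l2 : old X -> lead X l1 a al l2 -> X p = smul al (X a).
Proof. by move=> oX [E H Xa]; rewrite old_sign // (lsign_split E H Xa). Qed.

(** * Cocircuits that do not come from the deletion *)

Section New.
Variable Z : signvec T.
Hypotheses (ZD : Z \in D) (nZ : ~~ old Z).
Let F := zset Z :\ p.

Lemma new_p : Z p = Zer.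
Proof.
apply: NNPP => Zp; have [k kp Zk] := no_coloop ZD.
have [X [oX Xk sX]] := delete_old ZD kp Zk.
case/negP: nZ; have : zset Z \subset zset X.
  apply: subset_trans sX; apply/subsetP => q qZ; rewrite in_setD1 qZ andbT.
  by apply/eqP => E; apply: Zp; apply/zsetP; rewrite -E.
by case/(om_incomp OMD ZD (oldD oX)) => E; move: oX; rewrite E ?old_opp.
Qed.

Lemma new_line : crk D 2 F.
Proof.
apply: (crkW OMD (e := p)); rewrite setD1K; first exact: crk1_zset.
exact/zsetP/new_p.
Qed.

Lemma new_on : on D F Z. Proof. by rewrite /on ZD subD1set. Qed.

Lemma new_notp : p \notin F. Proof. by rewrite !inE eqxx. Qed.

Lemma new_onp Y : on D F Y -> Y p = Zer -> Y = Z \/ Y = oppv Z.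
Proof.
move=> oY Yp; apply: (om_incomp OMD ZD (onD oY)).
have := onU1 oY Yp; rewrite setD1K; first by case/andP.
by apply/zsetP/new_p.
Qed.

Lemma new_old_pt Y m : on D F Y -> m <> p -> Y m = Zer -> Z m <> Zer -> old Y.
Proof.
move=> oY mp Ym Zm; apply: (@old_pt (m |: F)); last exact: onU1.
  by rewrite in_setU1 negb_or new_notp andbT; apply/eqP => E; apply: mp.
by apply: new_line Zm => //; case/andP: new_on.
Qed.

(** If all lexicographic elements vanished at Z, they would vanish at an old point of its line too;
    that point would have p-sign zero and be Z up to sign. *)
Lemma new_lead : exists l1 a al l2, lead Z l1 a al l2.
Proof.
apply: lead_ex; apply: NNPP => N; have [k kp Zk] := no_coloop ZD.
have [X [oX Xk sX]] := delete_old ZD kp Zk.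
have oFX : on D F X by rewrite /on (oldD oX).
case/negP: nZ; have [|E|E] := new_onp oFX; last 2 first.
- by rewrite -E.
- by rewrite -old_opp -E.
rewrite old_sign //; apply: lsign0 => e ees; apply: (on0 oFX); rewrite !inE.
have [ep _] := esP ees; apply/andP; split; apply/eqP => // .
by apply: NNPP => Ze; apply: N; exists e.
Qed.

(** Y is the point where the leading element [a] vanishes on the line of Z. The sign at p is forced:
    in Z = Y + t W one has W_a = Z_a and so W_p = al Z_a, which Y_p must cancel. *)
Definition is_near Y := [/\ old Y, on D F Y, (forall h, h <> p -> Y h <> Zer -> Z h = Y h) &
  forall l1 a al l2, lead Z l1 a al l2 -> Y a = Zer /\ Y p = sopp (smul al (Z a))].

Lemma near_ex : exists Y, is_near Y.
Proof.
have [l1 [a [al [l2 L]]]] := new_lead; have [ap al0 l1p] := leadP L; have [_ _ Za] := L.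
have [X [oX Xa sX]] := delete_old ZD ap Za.
have oFX : on D F X by rewrite /on (oldD oX).
have nXZ1 : X <> Z by move=> E; case/negP: nZ; rewrite -E.
have nXZ2 : X <> oppv Z by move=> E; case/negP: nZ; rewrite -old_opp -E.
have lF := new_line; have oFZ := new_on.
have [Y0 oY0 Y0a] := line_meet OMD lF a oFZ oFX nXZ1 nXZ2.
have Y0p : Y0 p <> Zer.
  by move=> Y0p; have [E|E] := new_onp oY0 Y0p; apply: Za; rewrite -Y0a E ?ffunE //; move: Y0a; rewrite E ffunE; case: (Z a).
have [Y [oY Ya Yp]] : exists Y, [/\ on D F Y, Y a = Zer & Y p = sopp (smul al (Z a))].
  case: (classic (Y0 p = sopp (smul al (Z a)))) => E; first by exists Y0.
  exists (oppv Y0); rewrite on_opp // !ffunE Y0a; split=> //.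
  by move: E Y0p al0 Za; case: (Y0 p); case: (al); case: (Z a).
have Yp0 : Y p <> Zer by rewrite Yp; move: al0 Za; case: (al); case: (Z a).
exists Y; split=> //; first exact: (new_old_pt oY ap Ya Za).
  move=> h hp Yh.
  have nYZ1 : Y <> Z by move=> E; apply: Za; rewrite -E.
  have nYZ2 : Y <> oppv Z by move=> E; move: Za Ya; rewrite E ffunE; case: (Z a).
  (* The point V with h = 0 and V_a = Z_a has leading element [a], so its p-sign is opposite to that
     of Y. Eliminating p between V and Y gives Z, and at h only Y contributes. *)
  have [V0 oV0 V0h] := line_meet OMD lF h oFZ oY nYZ1 nYZ2.
  have V0a : V0 a <> Zer.
    move=> V0a; have [E|E] := pt_uniq OMD lF oFZ Za oV0 oY V0a Ya; apply: Yh; by rewrite E ?ffunE V0h.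
  have [V [oV Vh Va]] : exists V, [/\ on D F V, V h = Zer & V a = Z a].
    case: (classic (V0 a = Z a)) => E; first by exists V0.
    exists (oppv V0); rewrite on_opp // !ffunE V0h; split=> //.
    by move: E V0a Za; case: (V0 a); case: (Z a).
  have Vp : V p = smul al (Z a).
    rewrite -Va; apply: (old_lead (l1 := l1) (l2 := l2)).
      apply: (old_pt (A := h |: F)) (onU1 oV Vh).
        by rewrite in_setU1 negb_or new_notp andbT; apply/eqP => E; apply: hp.
      by apply: lF Yh; [apply: onD oY|case/andP: oY].
    case: L => E H _; split=> //; last by rewrite Va.
    by move=> e el; apply: (on0 oV); rewrite !inE H // eqxx andbT; apply/eqP/l1p.
  have [|||M [oM Mp SM]] := line_elim OMD lF oV oY (e := p).
  - by move=> E; move: Va Ya Za; rewrite E ffunE => <- ->.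
  - by move=> E; apply: Yp0; rewrite Yp -Vp E.
  - by rewrite Vp Yp soppK.
  have Ma : M a = Z a by move: (SM a); rewrite Va Ya; move: Za; case: (Z a); case: (M a).
  have [E|E] := new_onp oM Mp; last by move: Ma Za; rewrite E ffunE; case: (Z a).
  by move: (SM h); rewrite E Vh.
move=> k1 b be k2 L'; have [_ [-> -> _]] := lead_uniq L' L.
by [].
Qed.

End New.
Definition near Z : signvec T := if old Z then Z else epsilon (inhabits Z) (is_near Z).

Lemma near_new Z : Z \in D -> ~~ old Z -> is_near Z (near Z).
Proof. by move=> ZD nZ; rewrite /near (negbTE nZ); apply: epsilon_spec; apply: near_ex. Qed.

Lemma near_old Z : old Z -> near Z = Z.
Proof. by rewrite /near => ->. Qed.

Lemma nearP Z : Z \in D -> [/\ old (near Z), on D (zset Z :\ p) (near Z) &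
  forall h, h <> p -> near Z h <> Zer -> Z h = near Z h].
Proof.
move=> ZD; case: (boolP (old Z)) => oZ; last by have [] := near_new ZD oZ.
by rewrite near_old //; split=> //; rewrite /on ZD subD1set.
Qed.

Lemma near_p Z : Z \in D -> ~~ old Z -> near Z p <> Zer.
Proof.
move=> ZD nZ; have [l1 [a [al [l2 L]]]] := new_lead ZD nZ.
have [_ _ _ H] := near_new ZD nZ; have [_ ->] := H _ _ _ _ L.
by have [_ al0 _] := leadP L; case: L => _ _; move: al0; case: (al); case: (Z a).
Qed.

(* Point at infinity, with respect to [g], of the line through [Z] and [near Z]. *)
Definition is_infpt g Z W := [/\ on D (zset Z :\ p) W, W g = Zer & vsum (near Z) W Z].

Definition infpt g Z : signvec T := epsilon (inhabits Z) (is_infpt g Z).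

Lemma infptP g Z : Z \in D -> ~~ old Z -> g <> p -> near Z g <> Zer ->
  [/\ old (infpt g Z), is_infpt g Z (infpt g Z), infpt g Z p = sopp (near Z p) &
    forall l1 a al l2, lead Z l1 a al l2 -> infpt g Z a = Z a].
Proof.
move=> ZD nZ gp Yg; have [oY oFY nY H] := near_new ZD nZ.
have ex : exists W, is_infpt g Z W.
  have oFZ := new_on ZD.
  have [||W [oW Wg S]] := line_diff OMD (new_line ZD nZ) oFY oFZ _ Yg.
  - by move=> E; case/negP: nZ; rewrite -E.
  - by rewrite nY.
  by exists W.
have spec : is_infpt g Z (infpt g Z) := epsilon_spec _ _ ex.
move: (infpt g Z) spec => W spec; have [oW Wg S] := spec; split=> //.
- apply: (new_old_pt ZD nZ oW gp Wg).
  by rewrite nY.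
- by move: (S p) (near_p ZD nZ); rewrite (new_p ZD nZ); sgn_solve.
move=> l1 a al l2 /H [Ya _]; by move: (S a); rewrite Ya.
Qed.

(** * The terms of the potential of the extension *)

Definition old_potential g f (h : signvec T -> Z) :=
  (forall X, old X -> X g <> Zer -> zcmp 0 (h X) = X f) /\
  forall A X Y W, p \notin A -> crk D 2 A -> on D A X -> on D A Y -> on D A W ->
    old X -> old Y ->
    X g <> Zer -> X g = Y g -> W g = Zer -> vsum X W Y -> zcmp (h X) (h Y) = W f.

Hypothesis pots : forall g f, g <> p -> f <> p -> exists h : signvec T -> Z, old_potential g f h.

Definition ht g f : signvec T -> Z := epsilon (inhabits (fun=> 0%Z)) (old_potential g f).

Lemma htP g f : g <> p -> f <> p -> old_potential g f (ht g f).
Proof. by move=> gp fp; apply: epsilon_spec; apply: pots. Qed.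

(* Refines the value [X p / |X g|]. *)
Definition vec g X : seq Z := [seq zscale e.2 (ht g e.1 X) | e <- es].

Lemma size_vec g X : size (vec g X) = size es. Proof. exact: size_map. Qed.

Lemma notinU1 A m : p \notin A -> m <> p -> p \notin m |: A.
Proof. by move=> pA mp; rewrite in_setU1 negb_or pA andbT; apply/eqP => E; apply: mp. Qed.

Lemma vec_sign g X : g <> p -> old X -> X g <> Zer -> lcmp (nseq (size es) 0%Z) (vec g X) = X p.
Proof.
move=> gp oX Xg; rewrite old_sign // /vec; move: esP; elim: (es) => [//|[e al] l IH] /= H.
have [ep al0] := H (e, al) (mem_head _ _).
rewrite zcmp0_scale (proj1 (htP gp ep)) // IH => [|e' l']; last by apply: H; rewrite inE l' orbT.
by case: (X e); move: al0; case: (al).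
Qed.

(** W is old, so its p-sign comes from the first element that it sees; that is also the first entry
    in which the two sequences differ. *)
Lemma vec_cmp A X Y W g : g <> p -> p \notin A -> crk D 2 A -> on D A X -> on D A Y -> on D A W ->
  old X -> old Y -> X g <> Zer -> X g = Y g -> W g = Zer -> vsum X W Y ->
  lcmp (vec g X) (vec g Y) = W p.
Proof.
move=> gp pA lA oX oY oW olX olY Xg XYg Wg S.
have olW : old W.
  apply: (@old_pt (g |: A)) (onU1 oW Wg); first exact: notinU1.
  by apply: lA Xg; [apply: onD oX|case/andP: oX].
rewrite old_sign // /vec; move: esP; elim: (es) => [//|[e al] l IH] /= H.
have [ep al0] := H (e, al) (mem_head _ _).
rewrite zcmp_scale (proj2 (htP gp ep) A X Y W) // IH => [|e' l']; last by apply: H; rewrite inE l' orbT.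
by case: (W e); move: al0; case: (al).
Qed.

Definition zof s : Z := zscale s 1.

Lemma zof_cmp X Y W f : vsum X W Y -> X f <> Y f -> zcmp (zof (X f)) (zof (Y f)) = W f.
Proof. by move=> S; move: (S f); case: (X f); case: (Y f); case: (W f). Qed.

(* For new [Z = Y + t W], orders the second term [|p|/g (Y) * f/|p| (W)] of [f/g (Z)]; since
   [vec f W] refines [p/|f| (W)] rather than its inverse, it enters with the sign
   [- W_f W_p = W_f Y_p]. *)
Definition tail g f Z :=
  let W := infpt g Z in let Y := near Z in
  if old Z then 0%Z :: nseq (size es + (size es + size es)) 0%Z
  else zof (W f) :: [seq zscale (smul (W f) (Y p)) x | x <- first_nz (vec f W) ++ (vec g Y ++ vec f W)].

Definition key2 g f Z := ht g f (near Z) :: tail g f Z.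

(** If W_f = 0, the infinitesimal step from Y to Z does not change f/g, so Z must tie with an old
    point. *)
Lemma tail0 g f Z : old Z \/ infpt g Z f = Zer ->
  tail g f Z = 0%Z :: nseq (size es + (size es + size es)) 0%Z.
Proof.
rewrite /tail; case: ifP => // _ [//|->] /=; congr (_ :: _).
set s := _ ++ _; have <- : size s = size es + (size es + size es).
  by rewrite !size_cat size_first_nz !size_vec.
by elim: s => //= x s ->.
Qed.

Lemma size_tail g f Z : size (tail g f Z) = (size es + (size es + size es)).+1.
Proof.
rewrite /tail; case: ifP => _ /=; first by rewrite size_nseq.
by rewrite size_map !size_cat size_first_nz !size_vec.
Qed.

Lemma tail_new g f Z : ~~ old Z -> tail g f Z = zof (infpt g Z f) ::
  [seq zscale (smul (infpt g Z f) (near Z p)) x |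
     x <- first_nz (vec f (infpt g Z)) ++ (vec g (near Z) ++ vec f (infpt g Z))].
Proof. by rewrite /tail => /negbTE ->. Qed.

Lemma tail_body g f Z Z' : ~~ old Z -> ~~ old Z' -> infpt g Z f = infpt g Z' f ->
  near Z p = near Z' p ->
  lcmp (tail g f Z) (tail g f Z') = smul (smul (infpt g Z f) (near Z p))
   (sthen (lcmp (first_nz (vec f (infpt g Z))) (first_nz (vec f (infpt g Z'))))
      (sthen (lcmp (vec g (near Z)) (vec g (near Z')))
        (lcmp (vec f (infpt g Z)) (vec f (infpt g Z'))))).
Proof.
move=> nZ nZ' EW EY; rewrite !tail_new //= -EW -EY zcmpxx lcmp_scale.
by rewrite !lcmp_cat ?size_first_nz ?size_vec.
Qed.

(** Such an h vanishes on the whole line of Z, so differences that start at Z or at its near point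
    can be read off at h from their end point alone. *)
Lemma new_sep Z Q a : Z \in D -> ~~ old Z -> Z a <> Zer -> near Z a = Zer -> Q \in D -> Q a = Zer ->
  near Z <> Q -> near Z <> oppv Q -> exists2 h, h \in zset Z :\ p & Q h <> Zer.
Proof.
move=> ZD nZ Za Ya QD Qa n1 n2; apply: NNPP => N.
have oQ : on D (zset Z :\ p) Q.
  rewrite /on QD; apply/subzP => h hF; apply: NNPP => Qh; apply: N; by exists h.
have [_ oY _] := nearP ZD.
by have [E|E] := pt_uniq OMD (new_line ZD nZ) (new_on ZD) Za oQ oY Qa Ya.
Qed.

Lemma new_pt Z g m : Z \in D -> ~~ old Z -> Z g <> Zer -> near Z g = Zer -> m <> p -> near Z m <> Zer ->
  exists V, [/\ old V, on D (zset Z :\ p) V, V m = Zer & V g = Z g].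
Proof.
move=> ZD nZ Zg Yg mp Ym; have [olY oY nY] := nearP ZD; have lF := new_line ZD nZ.
have oZ := new_on ZD.
have [||V oV Vm] := line_meet OMD lF m oZ oY.
- by move=> E; case/negP: nZ; rewrite -E.
- by move=> E; case/negP: nZ; rewrite -old_opp -E.
have olV : old V by apply: (new_old_pt ZD nZ oV mp Vm); rewrite nY.
have Vg : V g <> Zer.
  move=> Vg; have [E|E] := pt_uniq OMD lF oZ Zg oV oY Vg Yg;
  by apply: Ym; rewrite E ?ffunE Vm.
case: (classic (V g = Z g)) => E; first by exists V.
exists (oppv V); rewrite old_opp on_opp // !ffunE Vm; split=> //.
by move: E Vg Zg; case: (V g); case: (Z g).
Qed.

(** Every difference on this line is the near point up to sign, and f vanishes there. *)
Lemma new_level Z g f V V1 : Z \in D -> ~~ old Z -> g <> p -> f <> p ->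
  near Z g = Zer -> near Z f = Zer -> old V -> old V1 ->
  on D (zset Z :\ p) V -> on D (zset Z :\ p) V1 -> V g <> Zer -> V g = V1 g -> ht g f V = ht g f V1.
Proof.
move=> ZD nZ gp fp Yg Yf olV olV1 oV oV1 Vg VVg; have [_ oY _] := nearP ZD.
have lF := new_line ZD nZ; case: (classic (V = V1)) => [->//|n].
have [W [oW Wg S]] := line_diff OMD lF oV oV1 n Vg VVg.
apply: zcmp0; rewrite (proj2 (htP gp fp) _ _ _ _ (new_notp Z) lF oV oV1 oW olV olV1 Vg VVg Wg S).
by have [->|->] := pt_uniq OMD lF oV Vg oY oW Yg Wg; rewrite ?ffunE Yf.
Qed.

Lemma old_sep X Y : old X -> Y \in D -> Y <> X -> Y <> oppv X ->
  exists m, [/\ m <> p, X m = Zer & Y m <> Zer].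
Proof.
move=> /oldP [XD H] YD n1 n2; apply: NNPP => N.
have [|E|E] := H Y YD => //; apply/subzP => m; rewrite !inE => /andP[/eqP mp /eqP Xm].
by apply: NNPP => Ym; apply: N; exists m.
Qed.

(** When f vanishes at the near point too, [new_level] makes the height independent of this
    choice. *)
Definition far g Z : signvec T :=
  epsilon (inhabits Z) (fun V => [/\ old V, on D (zset Z :\ p) V & V g = Z g]).

Lemma farP g Z : Z \in D -> ~~ old Z -> Z g <> Zer -> near Z g = Zer ->
  [/\ old (far g Z), on D (zset Z :\ p) (far g Z) & far g Z g = Z g].
Proof.
move=> ZD nZ Zg Yg; apply: (epsilon_spec (inhabits Z) (fun V => [/\ old V, on D (zset Z :\ p) V & V g = Z g])).
have [oY _ _] := nearP ZD; have [m mp Ym] := no_coloop (oldD oY).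
by have [V [oV oFV _ Vg]] := new_pt ZD nZ Zg Yg mp Ym; exists V.
Qed.

(** * Edges in the hyperplane of the new element *)

Section Plane.
Variables (Z Z' U : signvec T) (g : T) (l1 : seq (T * sgn)) (a : T) (al : sgn) (l2 : seq (T * sgn)).

(** The elements of [l1] vanish on the whole plane, so [a] is the leading element of every point of
    the plane that sees it. *)
Definition plane := [/\ [/\ Z \in D, Z' \in D & U \in D], [/\ Z p = Zer, Z' p = Zer & U p = Zer],
  [/\ g <> p, Z g <> Zer, Z g = Z' g & U g = Zer], vsum Z U Z' /\ conformal Z Z' &
  [/\ crk D 2 (zset Z :&: zset Z'), es = l1 ++ (a, al) :: l2,
      (forall e, e \in l1 -> Z e.1 = Zer /\ Z' e.1 = Zer) & Z a <> Zer \/ Z' a <> Zer]].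

Hypothesis PL : plane.
Let L := (zset Z :&: zset Z') :\ p.
Let ZD : Z \in D. Proof. by case: PL => -[]. Qed.
Let Z'D : Z' \in D. Proof. by case: PL => -[]. Qed.
Let UD : U \in D. Proof. by case: PL => -[]. Qed.
Let Zp : Z p = Zer. Proof. by case: PL => _ []. Qed.
Let Z'p : Z' p = Zer. Proof. by case: PL => _ []. Qed.
Let Up : U p = Zer. Proof. by case: PL => _ []. Qed.
Let gp : g <> p. Proof. by case: PL => _ _ []. Qed.
Let Zg : Z g <> Zer. Proof. by case: PL => _ _ []. Qed.
Let ZZg : Z g = Z' g. Proof. by case: PL => _ _ []. Qed.
Let Ug : U g = Zer. Proof. by case: PL => _ _ []. Qed.
Let SZ : vsum Z U Z'. Proof. by case: PL => _ _ _ []. Qed.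
Let esE : es = l1 ++ (a, al) :: l2. Proof. by case: PL => _ _ _ _ []. Qed.
Let ZZa : Z a <> Zer \/ Z' a <> Zer. Proof. by case: PL => _ _ _ _ []. Qed.
Let apal : a <> p /\ al <> Zer.
Proof. by have := esP; rewrite esE => /(_ (a, al)) H; apply: H; rewrite mem_cat mem_head orbT. Qed.
Let ap : a <> p. Proof. by case: apal. Qed.
Let al0 : al <> Zer. Proof. by case: apal. Qed.
Let l1L e : e \in l1 -> e.1 \in L.
Proof.
move=> el; case: PL => _ _ _ _ [_ _ H _]; have [E1 E2] := H e el; rewrite !inE E1 E2 !andbT.
by apply/eqP; have [] := esP (_ : e \in es); rewrite ?esE ?mem_cat ?el.
Qed.
Let pL : p \notin L. Proof. by rewrite !inE eqxx. Qed.

Lemma plane_corank : crk D 3 L.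
Proof.
apply: (crkW OMD (e := p)); rewrite setD1K; first by case: PL => _ _ _ _ [].
by rewrite !inE Zp Z'p.
Qed.

Lemma plane_onZ : on D L Z.
Proof. by rewrite /on ZD; apply/subsetP => h; rewrite !inE => /andP[_ /andP[]]. Qed.

Lemma plane_onZ' : on D L Z'.
Proof. by rewrite /on Z'D; apply/subsetP => h; rewrite !inE => /andP[_ /andP[]]. Qed.

Lemma plane_line m X : on D L X -> X m <> Zer -> crk D 2 (m |: L).
Proof. by move=> /andP[XD sX] Xm; exact: (plane_corank XD sX Xm). Qed.

Lemma plane_gline : crk D 2 (g |: L).
Proof. exact: plane_line plane_onZ Zg. Qed.

Lemma plane_aline : crk D 2 (a |: L).
Proof. by case: ZZa => [/(plane_line plane_onZ)|/(plane_line plane_onZ')]. Qed.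

Lemma plane_onU : on D (g |: L) U.
Proof.
apply: onU1 Ug; rewrite /on UD; apply/subzP => h hL.
by move: (SZ h); rewrite (on0 plane_onZ hL) (on0 plane_onZ' hL).
Qed.

Lemma plane_pg : p \notin g |: L. Proof. exact: notinU1. Qed.
Lemma plane_pa : p \notin a |: L. Proof. exact: notinU1. Qed.

Lemma plane_neq : Z <> Z'.
Proof. by move=> E; move: (SZ); rewrite -E; apply: (vsum_self OMD ZD UD Zg Ug). Qed.

Lemma plane_diff_pt : exists h, [/\ h <> p, Z h = Zer & Z' h <> Zer].
Proof.
apply: NNPP => N; have s : zset Z \subset zset Z'.
  apply/subsetP => h; rewrite !inE => /eqP Zh; apply/eqP; apply: NNPP => Z'h; apply: N.
  by exists h; split=> // E; apply: Z'h; rewrite E.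
have [E|E] := om_incomp OMD ZD Z'D s; first by apply: plane_neq.
by move: Zg ZZg; rewrite E ffunE; case: (Z g).
Qed.

Lemma plane_lead X : on D L X -> X a <> Zer -> lead X l1 a al l2.
Proof. by move=> oX Xa; split=> // e /l1L; apply: on0 oX. Qed.

Lemma plane_new X : on D L X -> X p = Zer -> X a <> Zer -> ~~ old X.
Proof.
move=> oX Xp Xa; apply/negP => olX; move: (old_lead olX (plane_lead oX Xa)).
by rewrite Xp; move: al0 Xa; case: (al); case: (X a).
Qed.

Lemma plane_onF X : on D L X -> X p = Zer -> L \subset zset X :\ p.
Proof.
move=> oX Xp; apply/subsetP => h hL; rewrite in_setD1; apply/andP; split; last exact/zsetP/(on0 oX).
by apply: contraNneq pL => <-.
Qed.

(** The near point lies on a = 0 in any case: by construction if [a] leads X, and because it keeps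
    the zeros of X off p otherwise. *)
Lemma plane_near X : on D L X -> X p = Zer ->
  [/\ old (near X), on D (a |: L) (near X), (forall h, h <> p -> near X h <> Zer -> X h = near X h) &
     X a <> Zer -> near X p = sopp (smul al (X a))].
Proof.
move=> oX Xp; have [oY oFY nY] := nearP (onD oX).
have sL := plane_onF oX Xp.
have Xa' : X a <> Zer -> near X a = Zer /\ near X p = sopp (smul al (X a)).
  move=> Xa; have nX := plane_new oX Xp Xa.
  have [_ _ _ H] := near_new (onD oX) nX; exact: (H _ _ _ _ (plane_lead oX Xa)).
split=> //; last by case/Xa'.
apply: onU1; first exact: on_sub sL oFY.
case: (classic (X a = Zer)) => [Xa|/Xa' [] //].
by apply: (on0 oFY); rewrite !inE Xa eqxx andbT; apply/eqP.
Qed.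

(* The points of the line at infinity on [p] and on [a] are infinitely near. *)
Lemma plane_nearU P Q : on D (g |: L) P -> P a <> Zer -> old Q -> on D (g |: L) Q -> Q a = Zer ->
  exists R, [/\ R = Q \/ R = oppv Q, forall h, h <> p -> R h <> Zer -> U h = R h &
    R p = sopp (smul al (U a))].
Proof.
move=> oP Pa olQ oQ Qa; have lg := plane_gline; have oU := plane_onU.
case: (classic (U a = Zer)) => Ua.
  have [E|E] := pt_uniq OMD lg oP Pa oQ oU Qa Ua.
  - by exists Q; split; [left|rewrite E|rewrite Ua -E Up; case: (al)].
  - exists (oppv Q); split; [by right|by rewrite E|].
    by rewrite Ua -E Up; case: (al).
have oLU : on D L U by apply: on_sub oU; apply: subsetUr.
have [oR oaR nR Rp] := plane_near oLU Up.
exists (near U); split=> //; last exact: Rp.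
apply: (pt_uniq OMD lg oU Ua oQ _ Qa (on0 oaR (setU11 _ _))).
apply: onU1; first by apply: on_sub oaR; apply: subsetUr.
have [_ oF _] := nearP UD.
by apply: (on0 oF); rewrite !inE Ug eqxx andbT; apply/eqP.
Qed.

Lemma plane_inf X : on D L X -> X p = Zer -> ~~ old X -> X g <> Zer -> near X g <> Zer ->
  [/\ old (infpt g X), on D (g |: L) (infpt g X), infpt g X p = sopp (near X p) &
    infpt g X a = X a].
Proof.
move=> oX Xp nX Xg Yg; have [oW [oFW Wg S] Wp H] := infptP (onD oX) nX gp Yg.
have sL := plane_onF oX Xp.
split=> //; first by apply: onU1 => //; apply: on_sub oFW.
case: (classic (X a = Zer)) => Xa; last exact: (H _ _ _ _ (plane_lead oX Xa)).
by rewrite Xa; apply: (on0 oFW); rewrite !inE Xa eqxx andbT; apply/eqP.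
Qed.

(** Only the factor f/|p| (W) moves: U is the difference of the two points W and W' at infinity. *)
Lemma key2_same f : f <> p -> near Z = near Z' -> near Z g <> Zer ->
  lcmp (key2 g f Z) (key2 g f Z') = U f.
Proof.
move=> fp EY Yg; have oZ := plane_onZ; have oZ' := plane_onZ'; have oU := plane_onU.
have nZ : ~~ old Z.
  apply/negP => olZ; case: (boolP (old Z')) => olZ'.
    by apply: plane_neq; rewrite -(near_old olZ) -(near_old olZ').
  by apply: (near_p Z'D olZ'); rewrite -EY near_old.
have nZ' : ~~ old Z'.
  by apply/negP => olZ'; apply: (near_p ZD nZ); rewrite EY near_old.
have Z'g : Z' g <> Zer by rewrite -ZZg.
have Y'g : near Z' g <> Zer by rewrite -EY.
have [oW ogW Wp _] := plane_inf oZ Zp nZ Zg Yg.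
have [oW' ogW' W'p _] := plane_inf oZ' Z'p nZ' Z'g Y'g.
have [_ [oFW Wg SW] _ _] := infptP ZD nZ gp Yg.
have [_ [oFW' W'g SW'] _ _] := infptP Z'D nZ' gp Y'g.
have [_ oFY _] := nearP ZD.
have Yp := near_p ZD nZ.
have [h [hp Zh Z'h]] := plane_diff_pt.
have hF : h \in zset Z :\ p by rewrite !inE Zh eqxx andbT; apply/eqP.
have Wh := on0 oFW hF.
have W'h : infpt g Z' h = Z' h by move: (SW' h); rewrite -EY (on0 oFY hF).
have E_Y : lcmp (vec g (near Z)) (vec g (near Z')) = Zer by rewrite EY lcmpxx.
have body := tail_body (f := f) nZ nZ' _ (congr1 (fun Y : signvec T => Y p) EY).
have [tZ tZ'] := (tail_new g f nZ, tail_new g f nZ').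
rewrite /key2 /= EY zcmpxx.
set W := infpt g Z in Wp oW ogW oFW Wg SW Wh body tZ *.
set W' := infpt g Z' in W'p oW' ogW' oFW' W'g SW' W'h body tZ' *.
have lg := plane_gline.
have nWW : W <> W' by move=> E; apply: Z'h; rewrite -W'h -E.
have Wp0 : W p <> Zer by rewrite Wp; case: (near Z p) Yp.
have WWp : W p = W' p by rewrite Wp W'p EY.
(* W and W' agree at p, so their difference at p = 0 is U up to sign; h, where Z vanishes and Z'
   does not, fixes the sign. *)
have SU : vsum W U W'.
  have [U2 [oU2 U2p S2]] := line_diff OMD lg ogW ogW' nWW Wp0 WWp.
  have [<-//|E] := pt_uniq OMD lg ogW Wp0 oU oU2 Up U2p.
  case: Z'h; move: (S2 h) (SZ h); rewrite E Wh W'h Zh ffunE /=.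
  by move=> ->; case: (U h).
case: (classic (W f = W' f)) => [EWf|nWf]; last first.
  rewrite tZ tZ' /= (zof_cmp SU nWf); case E: (U f) => //.
  by move: (SU f) nWf; rewrite E; case: (W f); case: (W' f).
rewrite body //.
case: (classic (W f = Zer)) => Wf0; first by move: (SU f); rewrite -EWf Wf0 /= => ->.
(* [vec f] orders by p/|f|, so U_f is recovered by exchanging f with p; this produces the factor W_f
   Y_p of [tail]. *)
have [V [oV Vf SV]] := line_diff OMD lg ogW ogW' nWW Wf0 EWf.
have Vp := line_swap OMD lg ogW ogW' oU oV Wp0 WWp Wf0 EWf SU Up SV Vf.
have EV := vec_cmp fp plane_pg lg ogW ogW' oV oW oW' Wf0 EWf Vf SV.
have -> : sthen (lcmp (first_nz (vec f W)) (first_nz (vec f W')))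
      (sthen (lcmp (vec g (near Z)) (vec g (near Z'))) (lcmp (vec f W) (vec f W'))) = V p.
  rewrite E_Y EV /=; have [|->//|->] := @lcmp_first_nz (vec f W) (vec f W').
    by rewrite !size_vec.
  by rewrite EV; case: (V p).
rewrite Vp Wp; move: Yp Wf0; case: (near Z p); case: (W f); case: (U f) => //.
Qed.

(** The first entries compare the near points and give Q_f, where Q is their difference and is
    infinitely near U. The tail is consulted when Q_f = 0. *)
Lemma key2_diff f : f <> p -> near Z <> near Z' -> near Z g <> Zer -> near Z' g <> Zer ->
  Z a <> Zer -> lcmp (key2 g f Z) (key2 g f Z') = U f.
Proof.
move=> fp nYY Yg Y'g Za; have oZ := plane_onZ; have oZ' := plane_onZ'; have oU := plane_onU.
have lg := plane_gline; have la := plane_aline.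
have nZ := plane_new oZ Zp Za.
have Z'g : Z' g <> Zer by rewrite -ZZg.
have [olY oaY nY YpE] := plane_near oZ Zp; have [olY' oaY' nY' Y'pE] := plane_near oZ' Z'p.
have {}YpE := YpE Za.
have Yp := near_p ZD nZ.
have EYg : near Z g = near Z' g by rewrite -nY // -nY'.
have [_ oFY _] := nearP ZD.
have [oW ogW Wp Wa] := plane_inf oZ Zp nZ Zg Yg.
have Wa0 : infpt g Z a <> Zer by rewrite Wa.
have [Q [oaQ Qg SQ]] := line_diff OMD la oaY oaY' nYY Yg EYg.
have ogaQ := onU1 oaQ Qg.
have Qa : Q a = Zer by apply: (on0 oaQ); rewrite setU11.
have ogQ : on D (g |: L) Q by apply: onU1 => //; apply: on_sub oaQ; apply: subsetUr.
have olQ : old Q.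
  apply: (old_pt _ _ ogaQ); first exact/notinU1/gp/plane_pa.
  by apply: la Yg; [apply: onD oaY|case/andP: oaY].
have [||h hF Y'h] := new_sep ZD nZ Za (on0 oaY (setU11 _ _)) (onD oaY') (on0 oaY' (setU11 _ _)).
- exact: nYY.
- by move=> E; move: EYg Yg; rewrite E ffunE; case: (near Z' g).
have [hp Zh] : h <> p /\ Z h = Zer by move: hF; rewrite !inE => /andP[/eqP hp /eqP].
have Uh : U h = near Z' h by move: (SZ h); rewrite Zh (nY' h hp Y'h).
have Qh : Q h = near Z' h by move: (SQ h); rewrite (on0 oFY hF) /=.
have [nearQ Qp] : (forall h, h <> p -> Q h <> Zer -> U h = Q h) /\ Q p = sopp (smul al (U a)).
  have [R [[->//|E] nR Rp]] := plane_nearU ogW Wa0 olQ ogQ Qa.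
  have cn : sopp (near Z' h) <> Zer by case: (near Z' h) Y'h.
  by move: (nR h hp); rewrite E ffunE Uh Qh => /(_ cn); case: (near Z' h) Y'h.
have lev := proj2 (htP gp fp) _ _ _ _ plane_pa la oaY oaY' oaQ olY olY' Yg EYg Qg SQ.
rewrite /key2 /= lev.
case: (classic (Q f = Zer)) => Qf; last by rewrite nearQ //; case: (Q f) Qf.
(* Both [a] and [f] vanish at Q, so on the line at infinity signs at [f] follow from signs at
   [a]. *)
rewrite Qf /=; have parf X : on D (g |: L) X -> infpt g Z a = X a -> infpt g Z f = X f.
  by move=> oX; apply: (line_par OMD lg ogQ Qa Qf ogW oX Wa0).
have parf' X : on D (g |: L) X -> infpt g Z a = sopp (X a) -> infpt g Z f = sopp (X f).
  by move=> oX; apply: (line_par_opp OMD lg ogQ Qa Qf ogW oX Wa0).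
case: (classic (Z' a = Zer)) => Z'a.
  have -> : tail g f Z' = 0%Z :: nseq (size es + (size es + size es)) 0%Z.
    apply: tail0; case: (boolP (old Z')) => nZ'; [by left|right].
    have [_ ogW' _ W'a] := plane_inf oZ' Z'p nZ' Z'g Y'g; rewrite Z'a in W'a.
    by have [->|->] := pt_uniq OMD lg ogW Wa0 ogQ ogW' Qa W'a; rewrite ?ffunE Qf.
  have Ua : infpt g Z a = sopp (U a) by rewrite Wa; move: (SZ a); rewrite Z'a; sgn_solve.
  have EUf := parf' _ oU Ua.
  case: (classic (infpt g Z f = Zer)) => Wf.
    by rewrite tail0; [rewrite lcmpxx; move: EUf; rewrite Wf; case: (U f)|right].
  by rewrite tail_new //=; move: EUf Wf; case: (U f) => /= ->.
have EZa : Z' a = Z a.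
  have : conformal Z Z' by case: PL => _ _ _ [].
  by move/setP/(_ a); rewrite !inE; move: Za Z'a; case: (Z a); case: (Z' a).
have nZ' := plane_new oZ' Z'p Z'a.
have [oW' ogW' W'p W'a] := plane_inf oZ' Z'p nZ' Z'g Y'g.
have WWa : infpt g Z a = infpt g Z' a by rewrite Wa W'a EZa.
have EWf := parf _ ogW' WWa.
have EYp : near Z p = near Z' p by rewrite YpE Y'pE ?EZa.
rewrite tail_body //; case: (classic (infpt g Z f = Zer)) => Wf.
  by rewrite Wf (line_par0 OMD lg ogQ Qa Qf ogW Wa0 Wf oU).
set W := infpt g Z in Wp Wa Wa0 oW ogW parf parf' WWa EWf Wf *.
set W' := infpt g Z' in W'p W'a oW' ogW' WWa EWf *.
have cmpW m : m <> p -> Q m = Zer \/ m \in L -> ht f m W = ht f m W'.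
  move=> mp Qm; case: (classic (W = W')) => [->//|nWW].
  have [V [oV Vf SV]] := line_diff OMD lg ogW ogW' nWW Wf EWf.
  apply: zcmp0; rewrite (proj2 (htP fp mp) _ _ _ _ plane_pg lg ogW ogW' oV oW oW' Wf EWf Vf SV).
  have [->|->] := pt_uniq OMD lg ogW Wf ogQ oV Qf Vf; rewrite ?ffunE;
    by have -> : Q m = Zer by case: Qm => // mL; apply: (on0 ogQ); rewrite in_setU1 mL orbT.
(* Elements of [l1] vanish on the plane, and W, W' differ by Q up to sign, where [a] vanishes: the
   entries up to [a] agree. The entry of [a] is nonzero, so the leading term ends there at the
   latest. *)
have -> : first_nz (vec f W) = first_nz (vec f W').
  rewrite /vec esE !map_cat /=.
  have -> : [seq zscale e.2 (ht f e.1 W) | e <- l1] = [seq zscale e.2 (ht f e.1 W') | e <- l1].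
    apply/eq_in_map => e el; rewrite cmpW //; last by right; apply: l1L.
    by move=> E; move: (l1L el); rewrite E (negbTE pL).
  rewrite (cmpW a ap); last by left.
  apply: first_nz_cat; last by rewrite !size_map.
  rewrite -(cmpW a ap); last by left.
  move: (proj1 (htP fp ap) W oW Wf) Wa0 al0 => <-.
  by case: (al) => //=; move: (ht f a W) => x; zcmp_solve.
rewrite lcmpxx /= (vec_cmp gp plane_pa la oaY oaY' oaQ olY olY' Yg EYg Qg SQ).
(* If Q_p is nonzero, Q_p Y_p = U_a Z_a, which parallelism turns into W_f U_f. If Q_p = 0, then U_a
   = 0, U is Q up to sign, and everything ties. *)
case: (classic (Q p = Zer)) => Qp0; last first.
  have -> s : sthen (Q p) s = Q p by case: (Q p) Qp0.
  have Ua0 : U a <> Zer by move=> Ua; apply: Qp0; rewrite Qp Ua; case: (al).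
  have [Ua|Ua] : W a = U a \/ W a = sopp (U a).
    by move: Wa0 Ua0; case: (W a); case: (U a); auto.
  + rewrite -(parf _ oU Ua) Qp -Ua YpE -Wa; move: al0 Wa0; by case: (al); case: (W a); case: (W f).
  have := parf' _ oU Ua; move=> EUf.
  have -> : U f = sopp (W f) by rewrite EUf soppK.
  have EUa : U a = sopp (W a) by rewrite Ua soppK.
  by rewrite Qp EUa YpE -Wa; move: al0 Wa0; case: (al); case: (W a); case: (W f).
have Ua : U a = Zer by move: Qp; rewrite Qp0; move: al0; case: (al); case: (U a).
have Uf : U f = Zer.
  by have [->|->] := pt_uniq OMD lg ogW Wa0 ogQ oU Qa Ua; rewrite ?ffunE Qf.
rewrite Qp0 Uf /=; have -> : lcmp (vec f W) (vec f W') = Zer.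
  case: (classic (W = W')) => [->|nWW]; first exact: lcmpxx.
  have [V [oV Vf SV]] := line_diff OMD lg ogW ogW' nWW Wf EWf.
  rewrite (vec_cmp fp plane_pg lg ogW ogW' oV oW oW' Wf EWf Vf SV).
  by have [->|->] := pt_uniq OMD lg ogW Wf ogQ oV Qf Vf; rewrite ?ffunE Qp0.
by case: (W f); case: (near Z p).
Qed.
Let zeros : seq BinNums.Z := 0%Z :: nseq (size es + (size es + size es)) 0%Z.

Lemma plane_new_near g' : near Z g' = Zer -> Z g' <> Zer -> ~~ old Z.
Proof. by move=> Yg Zg'; apply/negP => olZ; apply: Zg'; rewrite -[Z]near_old. Qed.

(** Letters for the near point: A is finite (g nonzero), B is infinite with f nonzero, N has g = f =
    0. Here the near point of Z' is on both lines a = 0 and g = 0, hence infinitely near U; p or a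
    separating h fixes its sign. *)
Lemma plane_AB f : f <> p -> near Z g <> Zer -> near Z' g = Zer -> near Z' f <> Zer ->
  U f = near Z' f.
Proof.
move=> fp Yg Y'g Y'f; have oZ := plane_onZ; have oZ' := plane_onZ'.
have [olY oaY nY YpE] := plane_near oZ Zp; have [olY' oaY' nY' Y'pE] := plane_near oZ' Z'p.
set Q := near Z' in Y'g Y'f olY' oaY' nY' Y'pE *.
have Qa : Q a = Zer := on0 oaY' (setU11 _ _).
have ogQ : on D (g |: L) Q by apply: onU1 => //; apply: on_sub oaY'; apply: subsetUr.
have Z'f := nY' f fp Y'f.
case: (classic (Z a = Zer)) => Za.
  have Z'a : Z' a <> Zer by case: ZZa => // H; case: H.
  have Ua : U a = Z' a by move: (SZ a); rewrite Za => ->.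
  have Ua0 : U a <> Zer by rewrite Ua.
  have [R [ER nR Rp]] := plane_nearU plane_onU Ua0 olY' ogQ Qa.
  have ERQ : R = Q.
    case: ER => // E; have Qp := Y'pE Z'a; move: Rp; rewrite Ua E ffunE Qp.
    by move: al0 Z'a; case: (al); case: (Z' a).
  by rewrite -ERQ in Y'f *; apply: nR.
have nZ := plane_new oZ Zp Za.
have [oW ogW Wp Wa] := plane_inf oZ Zp nZ Zg Yg.
have Wa0 : infpt g Z a <> Zer by rewrite Wa.
have [||h hF Qh] := new_sep ZD nZ Za (on0 oaY (setU11 _ _)) (onD oaY') Qa.
- by move=> E; apply: Yg; rewrite E.
- by move=> E; apply: Yg; rewrite E ffunE Y'g.
have [hp Zh] : h <> p /\ Z h = Zer by move: hF; rewrite !inE => /andP[/eqP hp /eqP].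
have Uh : U h = Q h by move: (SZ h); rewrite Zh (nY' h hp Qh).
have [R [ER nR Rp]] := plane_nearU ogW Wa0 olY' ogQ Qa.
have ERQ : R = Q.
  case: ER => // E; have cn : sopp (Q h) <> Zer by case: (Q h) Qh.
  by move: (nR h hp); rewrite E ffunE Uh => /(_ cn); case: (Q h) Qh.
by rewrite -ERQ in Y'f *; apply: nR.
Qed.

(** If Z_a = 0, the far point is on a = 0 and has the height of the near point of Z', so the tail
    decides. Otherwise a suitable point of the line of Z is compared with that near point; at
    infinity f is parallel to an h that vanishes on the line of Z, and h identifies the difference
    with U. *)
Lemma plane_NA f : f <> p -> near Z g = Zer -> near Z f = Zer -> near Z' g <> Zer ->
  lcmp (ht g f (far g Z) :: zeros) (key2 g f Z') = U f.
Proof.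
move=> fp Yg Yf Y'g; have oZ := plane_onZ; have oZ' := plane_onZ'; have oU := plane_onU.
have lg := plane_gline; have la := plane_aline.
have nZ := plane_new_near Yg Zg; have [_ oFY _] := nearP ZD.
have [olY oaY nY YpE] := plane_near oZ Zp; have [olY' oaY' nY' Y'pE] := plane_near oZ' Z'p.
have Z'g : Z' g <> Zer by rewrite -ZZg.
have ogY : on D (g |: L) (near Z) by apply: onU1 => //; apply: on_sub oaY; apply: subsetUr.
have Ya : near Z a = Zer := on0 oaY (setU11 _ _).
have Y'a : near Z' a = Zer := on0 oaY' (setU11 _ _).
have [olV oV Vg] := farP ZD nZ Zg Yg.
have Y'gZ : near Z' g = Z g by rewrite ZZg nY'.
case: (classic (Z a = Zer)) => Za.
  have Z'a : Z' a <> Zer by case: ZZa => // H; case: H.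
  have Ua : U a = Z' a by move: (SZ a); rewrite Za => ->.
  have Ua0 : U a <> Zer by rewrite Ua.
  have oaV : on D (a |: L) (far g Z).
    apply: onU1; first by apply: on_sub oV; exact: plane_onF.
    by apply: (on0 oV); rewrite !inE Za eqxx andbT; apply/eqP.
  have -> : ht g f (far g Z) = ht g f (near Z').
    have Vg0 : far g Z g <> Zer by rewrite Vg.
    have VYg : far g Z g = near Z' g by rewrite Vg Y'gZ.
    case: (classic (far g Z = near Z')) => [->//|n].
    have [M [oM Mg S]] := line_diff OMD la oaV oaY' n Vg0 VYg.
    apply: zcmp0; rewrite (proj2 (htP gp fp) _ _ _ _ plane_pa la oaV oaY' oM olV olY' Vg0 VYg Mg S).
    by have [->|->] := pt_uniq OMD la oaY' Y'g oaY oM Yg Mg; rewrite ?ffunE Yf.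
  rewrite /key2 /= zcmpxx; have nZ' := plane_new oZ' Z'p Z'a.
  have [oW' ogW' _ W'a] := plane_inf oZ' Z'p nZ' Z'g Y'g.
  have -> : U f = infpt g Z' f.
    by apply: (line_par OMD lg ogY Ya Yf oU ogW' Ua0); rewrite Ua W'a.
  case: (classic (infpt g Z' f = Zer)) => W'f; first by rewrite tail0 ?lcmpxx //; right.
  by rewrite tail_new //=; case: (infpt g Z' f) W'f.
have [||h hF Y'h] := new_sep ZD nZ Za Ya (onD oaY') Y'a.
- by move=> E; apply: Y'g; rewrite -E.
- by move=> E; apply: Y'g; move: Yg; rewrite E ffunE; case: (near Z' g).
have [hp Zh] : h <> p /\ Z h = Zer by move: hF; rewrite !inE => /andP[/eqP hp /eqP].
have Uh : U h = near Z' h by move: (SZ h); rewrite Zh (nY' h hp Y'h).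
have Uh0 : U h <> Zer by rewrite Uh.
have Yh := on0 oFY hF.
have [||m [mp Y'm Ym]] := old_sep olY' (onD oaY).
- by move=> E; apply: Y'g; rewrite -E.
- by move=> E; apply: Y'g; move: Yg; rewrite E ffunE; case: (near Z' g).
have [V1 [olV1 oV1 V1m V1g]] := new_pt ZD nZ Zg Yg mp Ym.
have sL := plane_onF oZ Zp.
have omV1 : on D (m |: L) V1 by apply: onU1 => //; apply: on_sub oV1.
have omY' : on D (m |: L) (near Z') by apply: onU1 => //; apply: on_sub oaY'; apply: subsetUr.
have lm : crk D 2 (m |: L) by apply: plane_line Ym; apply: on_sub oaY; apply: subsetUr.
have V1g0 : V1 g <> Zer by rewrite V1g.
have V1Yg : V1 g = near Z' g by rewrite V1g Y'gZ.
have nV1 : V1 <> near Z' by move=> E; apply: Y'h; rewrite -E (on0 oV1 hF).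
have [M [oM Mg S]] := line_diff OMD lm omV1 omY' nV1 V1g0 V1Yg.
have ogM : on D (g |: L) M by apply: onU1 => //; apply: on_sub oM; apply: subsetUr.
have Mh : M h = near Z' h by move: (S h); rewrite (on0 oV1 hF) => ->.
have Mf : U f = M f by apply: (line_par OMD lg ogY Yh Yf oU ogM Uh0); rewrite Uh Mh.
have -> : ht g f (far g Z) = ht g f V1.
  by apply: (new_level ZD nZ); rewrite ?Vg ?V1g.
rewrite /key2 /= (proj2 (htP gp fp) _ _ _ _ _ lm omV1 omY' oM olV1 olY' V1g0 V1Yg Mg S) -?Mf; last exact: notinU1.
case: (classic (U f = Zer)) => Uf; last by case: (U f) Uf.
rewrite Uf tail0 ?lcmpxx //; case: (boolP (old Z')) => nZ'; [by left|right].
have [_ ogW' _ _] := plane_inf oZ' Z'p nZ' Z'g Y'g.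
exact: (line_par0 OMD lg ogY Yh Yf oU Uh0 Uf ogW').
Qed.

Lemma plane_NB f : f <> p -> near Z g = Zer -> near Z f = Zer -> near Z' g = Zer -> near Z' f <> Zer ->
  U f = near Z' f.
Proof.
move=> fp Yg Yf Y'g Y'f; have oZ := plane_onZ; have oZ' := plane_onZ'; have oU := plane_onU.
have lg := plane_gline; have la := plane_aline.
have nZ := plane_new_near Yg Zg; have [_ oFY _] := nearP ZD.
have [olY oaY nY YpE] := plane_near oZ Zp; have [olY' oaY' nY' Y'pE] := plane_near oZ' Z'p.
have ogY : on D (g |: L) (near Z) by apply: onU1 => //; apply: on_sub oaY; apply: subsetUr.
have ogY' : on D (g |: L) (near Z') by apply: onU1 => //; apply: on_sub oaY'; apply: subsetUr.
have n1 : near Z <> near Z' by move=> E; apply: Y'f; rewrite -E.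
have n2 : near Z <> oppv (near Z').
  by move=> E; apply: Y'f; move: Yf; rewrite E ffunE; case: (near Z' f).
have Za : Z a <> Zer.
  move=> Za; have [E|E] := pt_uniq OMD la (onU1 oZ Za) Zg oaY' oaY Y'g Yg; [exact: n1|exact: n2].
have [//|//|h hF Y'h] := new_sep ZD nZ Za (on0 oaY (setU11 _ _)) (onD oaY') (on0 oaY' (setU11 _ _)).
have [hp Zh] : h <> p /\ Z h = Zer by move: hF; rewrite !inE => /andP[/eqP hp /eqP].
have Uh : U h = near Z' h by move: (SZ h); rewrite Zh (nY' h hp Y'h).
by apply: (line_par OMD lg ogY (on0 oFY hF) Yf oU ogY'); rewrite Uh.
Qed.

(** With a common near point, the lines of Z and Z' are compared along a transversal m = 0. With two
    different near points (conformality excludes opposite ones), f vanishes at two points at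
    infinity, hence on all of g = 0. *)
Lemma plane_NN f : f <> p -> near Z g = Zer -> near Z f = Zer -> near Z' g = Zer -> near Z' f = Zer ->
  zcmp (ht g f (far g Z)) (ht g f (far g Z')) = U f.
Proof.
move=> fp Yg Yf Y'g Y'f; have oZ := plane_onZ; have oZ' := plane_onZ'; have oU := plane_onU.
have lg := plane_gline; have la := plane_aline.
have Z'g : Z' g <> Zer by rewrite -ZZg.
have nZ := plane_new_near Yg Zg; have [_ oFY _] := nearP ZD.
have nZ' : ~~ old Z' by apply/negP => olZ'; apply: Z'g; rewrite -[Z']near_old.
have [_ oFY' _] := nearP Z'D.
have [olY oaY nY YpE] := plane_near oZ Zp; have [olY' oaY' nY' Y'pE] := plane_near oZ' Z'p.
have ogY : on D (g |: L) (near Z) by apply: onU1 => //; apply: on_sub oaY; apply: subsetUr.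
have ogY' : on D (g |: L) (near Z') by apply: onU1 => //; apply: on_sub oaY'; apply: subsetUr.
have oLY : on D L (near Z) by apply: on_sub oaY; apply: subsetUr.
have sL := plane_onF oZ Zp; have sL' := plane_onF oZ' Z'p.
have [olV oV Vg] := farP ZD nZ Zg Yg.
have [olV' oV' V'g] := farP Z'D nZ' Z'g Y'g.
have lev V1 : old V1 -> on D (zset Z :\ p) V1 -> V1 g = Z g -> ht g f (far g Z) = ht g f V1.
  by move=> olV1 oV1 V1g; apply: (new_level ZD nZ) => //; rewrite Vg ?V1g.
have lev' V1 : old V1 -> on D (zset Z' :\ p) V1 -> V1 g = Z g -> ht g f (far g Z') = ht g f V1.
  by move=> olV1 oV1 V1g; apply: (new_level Z'D nZ') => //; rewrite V'g -?ZZg ?V1g.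
have cmp m V1 V2 : m <> p -> near Z m <> Zer -> old V1 -> old V2 -> on D L V1 -> on D L V2 ->
   V1 m = Zer -> V2 m = Zer -> V1 g = Z g -> V2 g = Z g -> V1 <> V2 ->
   exists M, [/\ on D (g |: L) M, vsum V1 M V2 & zcmp (ht g f V1) (ht g f V2) = M f].
  move=> mp Ym olV1 olV2 oV1 oV2 V1m V2m V1g V2g n.
  have lm := plane_line oLY Ym.
  have V1g0 : V1 g <> Zer by rewrite V1g.
  have V12 : V1 g = V2 g by rewrite V1g V2g.
  have [M [oM Mg S]] := line_diff OMD lm (onU1 oV1 V1m) (onU1 oV2 V2m) n V1g0 V12.
  exists M; split=> //; first by apply: onU1 => //; apply: on_sub oM; apply: subsetUr.
  apply: (proj2 (htP gp fp) _ _ _ _ _ lm (onU1 oV1 V1m) (onU1 oV2 V2m) oM) => //.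
  exact: notinU1.
case: (classic (near Z = near Z')) => [EY|nYY].
  have [h [hp Zh Z'h]] := plane_diff_pt.
  have hF : h \in zset Z :\ p by rewrite !inE Zh eqxx andbT; apply/eqP.
  have Yh := on0 oFY hF.
  have [m mp Ym] := no_coloop (oldD olY).
  have [V1 [olV1 oV1 V1m V1g]] := new_pt ZD nZ Zg Yg mp Ym.
  have Y'm : near Z' m <> Zer by rewrite -EY.
  have [V2 [olV2 oV2 V2m V2g]] := new_pt Z'D nZ' Z'g Y'g mp Y'm.
  have Y'h : near Z' h = Zer by rewrite -EY.
  have V2h : Z' h = V2 h.
    by apply: (line_par OMD (new_line Z'D nZ') oFY' Y'g Y'h (new_on Z'D) oV2).
  have n : V1 <> V2 by move=> E; apply: Z'h; rewrite V2h -E (on0 oV1 hF).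
  rewrite (lev V1) // (lev' V2) ?V2g //.
  have [|||M [oM SM ->]] := cmp m V1 V2 mp Ym olV1 olV2 _ _ V1m V2m V1g _ n; rewrite ?V2g //.
  - exact: on_sub oV1.
  - exact: on_sub oV2.
  have Uh : U h = Z' h by move: (SZ h); rewrite Zh => ->.
  apply/esym; apply: (line_par OMD lg ogY Yh Yf oU oM); first by rewrite Uh.
  by rewrite Uh V2h; move: (SM h); rewrite (on0 oV1 hF) => ->.
have nYY' : near Z <> oppv (near Z').
  move=> E; have cZ : conformal Z Z' by case: PL => _ _ _ [].
  have [k kp Yk] := no_coloop (oldD olY).
  have Y'k : near Z' k <> Zer by move: Yk; rewrite E ffunE; case: (near Z' k).
  move/setP/(_ k): cZ; rewrite !inE nY // nY' // E ffunE eqxx andbT.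
  by case: (near Z' k) Y'k.
have gf X : on D (g |: L) X -> X f = Zer.
  move=> oX; apply: NNPP => Xf.
  have [E|E] := pt_uniq OMD lg oX Xf ogY' ogY Y'f Yf; [exact: nYY|exact: nYY'].
have Z'a : Z' a <> Zer.
  move=> Z'a; have [E|E] := pt_uniq OMD la (onU1 oZ' Z'a) Z'g oaY' oaY Y'g Yg; [exact: nYY|exact: nYY'].
have [||h hF' Yh] := new_sep Z'D nZ' Z'a (on0 oaY' (setU11 _ _)) (onD oaY) (on0 oaY (setU11 _ _)).
- by move=> E; apply: nYY.
- by move=> E; apply: nYY'; rewrite E oppvK.
have hp : h <> p by move: hF'; rewrite !inE => /andP[/eqP].
have [V1 [olV1 oV1 V1h V1g]] := new_pt ZD nZ Zg Yg hp Yh.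
rewrite (lev V1) // gf //; case: (classic (V1 = far g Z')) => [->|n]; first exact: zcmpxx.
have [|||M [oM SM ->]] := cmp h V1 (far g Z') hp Yh olV1 olV' _ _ V1h (on0 oV' hF') V1g _ n; rewrite ?V'g //.
- exact: on_sub oV1.
- exact: on_sub oV'.
exact: gf.
Qed.

End Plane.

(** * The potential along all edges of the extension *)

Lemma plane_sym Z Z' U g l1 a al l2 : plane Z Z' U g l1 a al l2 -> plane Z' Z (oppv U) g l1 a al l2.
Proof.
case=> -[ZD Z'D UD] [Zp Z'p Up] [gp Zg ZZg Ug] [S c] [cr E H Za]; split; split; rewrite ?om_oppE //.
- by rewrite ffunE Up.
- by rewrite -ZZg.
- by rewrite ffunE Ug.
- exact: vsum_oppr.
- by apply/setP => h; move/setP/(_ h): c; rewrite !inE; case: (Z h); case: (Z' h).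
- by rewrite setIC.
- by move=> e /H [].
- by case: Za; auto.
Qed.

Lemma key2_plane Z Z' U g l1 a al l2 f : plane Z Z' U g l1 a al l2 -> f <> p ->
  near Z g <> Zer -> near Z' g <> Zer -> lcmp (key2 g f Z) (key2 g f Z') = U f.
Proof.
move=> PL fp Yg Y'g; case: (classic (near Z = near Z')) => [E|n]; first exact: (key2_same PL).
case: (PL) => _ _ _ _ [_ _ _ [Za|Z'a]]; first exact: (key2_diff PL).
have := key2_diff (plane_sym PL) fp (nesym n) Y'g Yg Z'a.
by rewrite lcmpC ffunE => /(congr1 sopp); rewrite !soppK.
Qed.

(* If [Y_g = 0] then [Z] is infinitely far: [f/g (Z)] is infinite when [Y_f <> 0], and is
   compared through its inverse [g/f]; when [Y_f = 0] as well, [f/g] is constant on the line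
   through [Z] and [Y], hence equal to its value at any other point of that line. *)
Definition key g f Z : seq BinNums.Z :=
  if near Z g == Zer then
    if near Z f == Zer then 0%Z :: ht g f (far g Z) :: 0%Z :: nseq (size es + (size es + size es)) 0%Z
    else zof (near Z f) :: [seq zscale (sopp (near Z f)) x | x <- key2 f g Z]
  else 0%Z :: key2 g f Z.

Lemma size_key g f Z : size (key g f Z) = (size es + (size es + size es)).+3.
Proof.
rewrite /key; do 2?case: ifP => _; rewrite /= ?size_map ?size_nseq /key2 /= ?size_tail //.
Qed.

Lemma key2_old g f Z : old Z ->
  key2 g f Z = ht g f Z :: 0%Z :: nseq (size es + (size es + size es)) 0%Z.
Proof. by move=> oZ; rewrite /key2 near_old // tail0 //; left. Qed.

Lemma key_old g f Z : old Z -> Z g <> Zer -> key g f Z = 0%Z :: key2 g f Z.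
Proof. by move=> oZ /eqP/negbTE Zg; rewrite /key near_old ?Zg. Qed.

Lemma key_plane Z Z' U g l1 a al l2 f : plane Z Z' U g l1 a al l2 -> f <> p -> Z g = Pos ->
  lcmp (key g f Z) (key g f Z') = U f.
Proof.
move=> PL fp Zg1; have PL' := plane_sym PL.
have [[ZD Z'D UD] [Zp Z'p Up] [gp Zg ZZg Ug] [SZ cZ] [cA esE H _]] := PL.
have inv x y : lcmp y x = oppv U f -> lcmp x y = U f.
  by rewrite lcmpC ffunE => /(congr1 sopp); rewrite !soppK.
have inv' s : oppv U f = s -> U f = sopp s by rewrite ffunE => <-; rewrite soppK.
have [_ _ nY] := nearP ZD; have [_ _ nY'] := nearP Z'D.
rewrite /key; case: eqP => Yg; [case: eqP => Yf|]; (case: eqP => Y'g; [case: eqP => Y'f|]).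
- by rewrite /= lcmpxx (plane_NN PL fp Yg Yf Y'g Y'f); case: (U f).
- by rewrite (plane_NB PL fp Yg Yf Y'g Y'f) /=; case: (near Z' f) Y'f.
- exact: (plane_NA PL fp Yg Yf Y'g).
- by rewrite (inv' _ (plane_NB PL' fp Y'g Y'f Yg Yf)) /=; case: (near Z f) Yf.
(* Both near points are infinite. For equal signs at f the plane is used with f in the place of g;
   inverting g/f costs the factor -Z_f, which the scaling in [key] undoes. *)
- have [EZf EZ'f] : Z f = near Z f /\ Z' f = near Z' f by rewrite nY ?nY'.
  case: (classic (Z f = Z' f)) => [EZ|nZ]; last first.
    rewrite /= -EZf -EZ'f (zof_cmp SZ nZ); case E: (U f) => //.
    by move: (SZ f) nZ; rewrite E; case: (Z f); case: (Z' f).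
  have Zf0 : Z f <> Zer by rewrite EZf.
  have oA X : X = Z \/ X = Z' -> on D (zset Z :&: zset Z') X.
    by case=> ->; rewrite /on ?ZD ?Z'D ?subsetIl ?subsetIr.
  have oZ := oA _ (or_introl erefl); have oZ' := oA _ (or_intror erefl).
  have [V [oV Vf SV]] := line_diff OMD cA oZ oZ' (plane_neq PL) Zf0 EZ.
  have oU : on D (zset Z :&: zset Z') U.
    rewrite /on UD; apply/subzP => h; rewrite !inE => /andP[/eqP Zh /eqP Z'h].
    by move: (SZ h); rewrite Zh Z'h.
  have Vp : V p = Zer by apply: (on0 oV); rewrite !inE Zp Z'p.
  have PV : plane Z Z' V f l1 a al l2.
    case: PL => _ _ _ _ PLa; split; [split=> //; exact: onD oV|by []|by []|by []|exact: PLa].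
  have := key2_plane PV gp Yf Y'f.
  have := line_swap OMD cA oZ oZ' oU oV Zg ZZg Zf0 EZ SZ Ug SV Vf => Vg E.
  by rewrite lcmp_cons -EZ'f -EZf EZ zcmpxx lcmp_scale E Vg -EZ Zg1; move: Zf0; case: (Z f); case: (U f).
- by rewrite (inv' _ (plane_AB PL' fp Y'g Yg Yf)) /=; case: (near Z f) Yf.
- exact/inv/(plane_NA PL' fp Y'g Y'f Yg).
- by rewrite (plane_AB PL fp Yg Y'g Y'f) /=; case: (near Z' f) Y'f.
exact: (key2_plane PL).
Qed.

(** The near point of Z' lies on the line of the edge itself, so U is, up to sign, the only point at
    infinity that occurs. If the near point is Z, the step is infinitesimal and the head of the tail
    decides. *)
Lemma key_old_new Z Z' U g f : old Z -> Z' \in D -> ~~ old Z' -> Z p <> Zer ->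
  crk D 2 (zset Z :&: zset Z') -> g <> p -> f <> p -> Z g <> Zer -> Z g = Z' g ->
  U \in D -> U g = Zer -> vsum Z U Z' -> lcmp (key g f Z) (key g f Z') = U f.
Proof.
move=> olZ Z'D nZ' Zp lA gp fp Zg ZZg UD Ug SZ.
set A := zset Z :&: zset Z' in lA.
have pA : p \notin A by rewrite !inE negb_and; apply/orP; left; apply/eqP.
have sA : A \subset zset Z' :\ p.
  apply/subsetP => h hA; rewrite in_setD1; apply/andP; split.
    by apply: contraNneq pA => <-.
  by move: hA; rewrite inE => /andP[].
have oZ : on D A Z by rewrite /on oldD // subsetIl.
have oU : on D A U.
  rewrite /on UD; apply/subzP => h; rewrite !inE => /andP[/eqP Zh /eqP Z'h].
  by move: (SZ h); rewrite Zh Z'h.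
have [olY oFY nY] := nearP Z'D; have oY : on D A (near Z') by apply: on_sub oFY.
have Z'g : Z' g <> Zer by rewrite -ZZg.
rewrite (key_old f olZ Zg) key2_old //.
have Usep : near Z' <> Z -> near Z' <> oppv Z -> exists m, [/\ Z m = Zer, U m = near Z' m & near Z' m <> Zer].
  move=> n1 n2; have [m [mp Zm Ym]] := old_sep olZ (onD oY) n1 n2.
  by exists m; split=> //; move: (SZ m); rewrite Zm (nY m mp Ym).
rewrite /key; case: eqP => Yg.
  have [||m [Zm Um Ym]] := Usep.
  - by move=> E; apply: Zg; rewrite -E.
  - by move=> E; apply: Zg; move: Yg; rewrite E ffunE; case: (Z g).
  have -> : U = near Z'.
    have [//|E] := pt_uniq OMD lA oZ Zg oY oU Yg Ug.
    by move: Um Ym; rewrite E ffunE; case: (near Z' m).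
  case: eqP => Yf; last by rewrite /=; case: (near Z' f) Yf.
  have [olV oFV Vg] := farP Z'D nZ' Z'g Yg; have oV : on D A (far g Z') by apply: on_sub oFV.
  have -> : ht g f (far g Z') = ht g f Z.
    case: (classic (Z = far g Z')) => [<-//|n].
    have ZVg : Z g = far g Z' g by rewrite ZZg Vg.
    have [M [oM Mg S]] := line_diff OMD lA oZ oV n Zg ZVg.
    apply/esym; apply: zcmp0; rewrite (proj2 (htP gp fp) _ _ _ _ pA lA oZ oV oM olZ olV Zg ZVg Mg S).
    by have [->|->] := pt_uniq OMD lA oZ Zg oY oM Yg Mg; rewrite ?ffunE Yf.
  by rewrite lcmpxx Yf.
have [oW [oFW Wg SW] Wp HW] := infptP Z'D nZ' gp Yg.
have oAW : on D A (infpt g Z') by apply: on_sub oFW.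
rewrite /key2 /=.
case: (classic (near Z' = Z)) => EY.
  have [l1 [a [al [l2 Ld]]]] := new_lead Z'D nZ'; have [_ _ Z'a] := Ld.
  have [_ _ _ /(_ _ _ _ _ Ld) [Ya _]] := near_new Z'D nZ'; rewrite EY in Ya.
  have -> : U = infpt g Z'.
    have [//|E] := pt_uniq OMD lA oZ Zg oAW oU Wg Ug.
    have := HW _ _ _ _ Ld; move: (SZ a); rewrite Ya E ffunE => /= EZa Wa.
    by move: EZa Z'a; rewrite Wa; case: (Z' a).
  rewrite EY zcmpxx /=.
  case: (classic (infpt g Z' f = Zer)) => Wf; first by rewrite tail0 ?lcmpxx //; right.
  by rewrite tail_new //=; case: (infpt g Z' f) Wf.
have YZg : Z g = near Z' g by rewrite -nY.
have [Q [oQ Qg SQ]] := line_diff OMD lA oZ oY (nesym EY) Zg YZg.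
have [//||m [Zm Um Ym]] := Usep.
  by move=> E; move: YZg Zg; rewrite E ffunE; case: (Z g).
have -> : U = Q.
  have [//|E] := pt_uniq OMD lA oZ Zg oQ oU Qg Ug.
  by move: (SQ m) Ym; rewrite Zm -Um E ffunE /=; case: (Q m).
rewrite (proj2 (htP gp fp) _ _ _ _ pA lA oZ oY oQ olZ olY Zg YZg Qg SQ).
case: (classic (Q f = Zer)) => Qf; last by case: (Q f) Qf.
rewrite Qf tail0 ?lcmpxx //; right.
by have [->|->] := pt_uniq OMD lA oZ Zg oQ oAW Qg Wg; rewrite ?ffunE Qf.
Qed.

Lemma key_old_old Z Z' U g f : old Z -> old Z' ->
  crk D 2 (zset Z :&: zset Z') -> g <> p -> f <> p -> Z g <> Zer -> Z g = Z' g ->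
  U \in D -> U g = Zer -> vsum Z U Z' -> lcmp (key g f Z) (key g f Z') = U f.
Proof.
move=> olZ olZ' lA gp fp Zg ZZg UD Ug SZ.
have Z'g : Z' g <> Zer by rewrite -ZZg.
rewrite !key_old // !key2_old //= lcmpxx.
have pA : p \notin (zset Z :&: zset Z') :\ p by rewrite !inE eqxx.
(* Old potentials want a flat spanned without p. If p vanishes at both old points, so do all
   lexicographic elements, and these already force p = 0 on the line. *)
have cA : crk D 2 ((zset Z :&: zset Z') :\ p).
  case: (boolP (p \in zset Z :&: zset Z')) => pZ; last first.
    by move: lA; congr (crk _ _ _); apply/setP => h; rewrite in_setD1; case: eqP => // ->; apply/negbTE.
  apply: crk_clos lA => X XD sX; rewrite -(setD1K pZ) subUset sX andbT sub1set; apply/zsetP.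
  case: (boolP (old X)) => oX; last exact: new_p.
  rewrite old_sign //; apply: lsign0 => e ees; have [ep _] := esP ees.
  have es0 Y : old Y -> Y p = Zer -> Y e.1 = Zer.
    move=> oY Yp; apply: NNPP => Ye; have [l1 [a [al [l2 L]]]] := lead_ex (ex_intro2 _ _ e ees Ye).
    have [_ al0 _] := leadP L; have := old_lead oY L; rewrite Yp; case: L => _ _.
    by move: al0; case: (al); case: (Y a).
  move: pZ; rewrite !inE => /andP[/eqP Zp /eqP Z'p].
  by move/subzP: sX; apply; rewrite !inE (es0 Z) // (es0 Z') // eqxx !andbT; apply/eqP.
have oA X : X \in D -> (forall h, Z h = Zer -> Z' h = Zer -> X h = Zer) ->
    on D ((zset Z :&: zset Z') :\ p) X.
  move=> XD H; rewrite /on XD; apply/subzP => h; rewrite !inE => /andP[_ /andP[/eqP ? /eqP ?]].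
  exact: H.
rewrite (proj2 (htP gp fp) _ Z Z' U pA cA) //.
- by case: (U f).
- by apply: oA => //; apply: oldD.
- by apply: oA => //; apply: oldD.
by apply: oA => // h Zh Z'h; move: (SZ h); rewrite Zh Z'h.
Qed.

Lemma key_edge g f Z Z' U : g <> p -> f <> p -> cg_edge D g Z Z' ->
  U \in D -> U g = Zer -> vsum Z U Z' -> lcmp (key g f Z) (key g f Z') = U f.
Proof.
move=> gp fp [[ZD Zg] [Z'D Z'g] cZ com] UD Ug SZ.
have lA := line_comodular OMD com.
have Zg0 : Z g <> Zer by rewrite Zg.
have Z'g0 : Z' g <> Zer by rewrite Z'g.
have ZZg : Z g = Z' g by rewrite Zg Z'g.
case: (boolP (old Z && old Z')) => [/andP[olZ olZ']|]; first exact: key_old_old.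
rewrite negb_and => nold.
have oldp X : X \in D -> X p <> Zer -> old X.
  by move=> XD Xp; apply/negPn/negP => nX; apply: Xp; apply: new_p.
case: (classic (Z p = Zer)) => Zp; last first.
  have olZ := oldp Z ZD Zp; rewrite olZ /= in nold.
  exact: key_old_new.
case: (classic (Z' p = Zer)) => Z'p; last first.
  have olZ' := oldp Z' Z'D Z'p; rewrite olZ' orbF in nold.
  have := @key_old_new Z' Z (oppv U) g f olZ' ZD nold Z'p.
  rewrite setIC om_oppE // !ffunE Ug => /(_ lA gp fp Z'g0 (esym ZZg) UD erefl (vsum_oppr SZ)).
  by rewrite lcmpC => /(congr1 sopp); rewrite !soppK.
have Up : U p = Zer by move: (SZ p); rewrite Zp Z'p.
have comp0 h : compose Z Z' h = Zer <-> Z h = Zer /\ Z' h = Zer.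
  by rewrite ffunE; case: (Z h); case: (Z' h) => //=; intuition congruence.
(* The leading element of the plane is that of the edge covector; it exists because one end is
   new. *)
have [l1 [a [al [l2 [E H Ha]]]]] : exists l1 a al l2, lead (compose Z Z') l1 a al l2.
  apply: lead_ex; apply: NNPP => N.
  have no X : X \in D -> ~~ old X -> (forall h, compose Z Z' h = Zer -> X h = Zer) -> False.
    move=> XD nX HX; have [l1 [a [al [l2 [E _ Xa]]]]] := new_lead XD nX; apply: N.
    exists (a, al); first by rewrite E mem_cat mem_head orbT.
    by move=> /= /HX.
  by case/orP: nold => nX; [apply: (no Z)|apply: (no Z')] => // h /comp0 [].
apply: (key_plane (l1 := l1) (a := a) (al := al) (l2 := l2)) => //.
split; split=> //; first by move=> e /H /comp0.
apply: NNPP => N; apply: Ha; apply/comp0; split; apply: NNPP => Xa; apply: N; by [left|right].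
Qed.

(** Every point with p = 0 gets the zero key. If both ends see p, they are old and their line is
    spanned without p. *)
Lemma euclid_objective g : g <> p -> euclidean_program D g p.
Proof.
move=> gp; pose K X := if old X then vec g X else nseq (size es) 0%Z.
apply: (@no_directed_cycle _ D g p K (size es)) => [X|Z Z' U].
  by rewrite /K; case: ifP => _; rewrite ?size_vec ?size_nseq.
case=> -[ZD Zg] [Z'D Z'g] cZ com UD Ug SZ; have lA := line_comodular OMD com.
have Kp X : X \in D -> X g = Pos -> lcmp (nseq (size es) 0%Z) (K X) = X p.
  move=> XD Xg; rewrite /K; case: ifP => oX; first by apply: vec_sign => //; rewrite Xg.
  by rewrite lcmpxx new_p ?oX.
have K0 X : X \in D -> X g = Pos -> X p = Zer -> K X = nseq (size es) 0%Z.
  move=> XD Xg Xp; apply/esym/lcmp0; last by rewrite Kp.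
  by rewrite /K; case: ifP => _; rewrite ?size_vec ?size_nseq.
case: (classic (Z p = Zer)) => Zp.
  by rewrite (K0 Z) // Kp //; move: (SZ p); rewrite Zp.
case: (classic (Z' p = Zer)) => Z'p.
  rewrite (K0 Z') // lcmpC Kp //; move: (SZ p); rewrite Z'p.
  by move: Zp; case: (Z p); case: (U p).
have ol X : X \in D -> X p <> Zer -> old X.
  by move=> XD Xp; apply/negPn/negP => nX; apply: Xp; apply: new_p.
rewrite /K !ol //; apply: (vec_cmp gp _ lA) => //; rewrite ?Zg ?Z'g ?ol //.
- by rewrite !inE negb_and; apply/orP; left; apply/eqP.
- by rewrite /on ZD subsetIl.
- by rewrite /on Z'D subsetIr.
rewrite /on UD; apply/subzP => h; rewrite !inE => /andP[/eqP Zh /eqP Z'h].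
by move: (SZ h); rewrite Zh Z'h.
Qed.

(** All vertices see p and are old; f/p is ordered by the sign of f and then by the inverse of
    p/f. *)
Lemma euclid_infinity f : f <> p -> euclidean_program D p f.
Proof.
move=> fp; pose K X := zof (X f) :: [seq zscale (sopp (X f)) x | x <- vec f X].
apply: (@no_directed_cycle _ D p f K (size es).+1) => [X|Z Z' U].
  by rewrite /K /= size_map size_vec.
case=> -[ZD Zp] [Z'D Z'p] cZ com UD Up SZ; have lA := line_comodular OMD com.
have ol X : X \in D -> X p = Pos -> old X.
  by move=> XD Xp; apply/negPn/negP => nX; move: Xp; rewrite new_p.
have Zp0 : Z p <> Zer by rewrite Zp.
have ZZp : Z p = Z' p by rewrite Zp Z'p.
rewrite /K lcmp_cons; case: (classic (Z f = Z' f)) => [Ef|nf]; last first.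
  rewrite (zof_cmp SZ nf); case E: (U f) => //.
  by move: (SZ f) nf; rewrite E; case: (Z f); case: (Z' f).
rewrite -Ef zcmpxx lcmp_scale /=.
case: (classic (Z f = Zer)) => Zf; first by move: (SZ f); rewrite -Ef Zf /= => ->.
have pA : p \notin zset Z :&: zset Z' by rewrite !inE Zp.
have oZ : on D (zset Z :&: zset Z') Z by rewrite /on ZD subsetIl.
have oZ' : on D (zset Z :&: zset Z') Z' by rewrite /on Z'D subsetIr.
have oU : on D (zset Z :&: zset Z') U.
  rewrite /on UD; apply/subzP => h; rewrite !inE => /andP[/eqP Zh /eqP Z'h].
  by move: (SZ h); rewrite Zh Z'h.
have n : Z <> Z' by case: com.
have [V [oV Vf SV]] := line_diff OMD lA oZ oZ' n Zf Ef.
rewrite (vec_cmp fp pA lA oZ oZ' oV (ol Z ZD Zp) (ol Z' Z'D Z'p) Zf Ef Vf SV).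
rewrite (line_swap OMD lA oZ oZ' oU oV Zp0 ZZp Zf Ef SZ Up SV Vf) Zp.
by move: Zf; case: (Z f); case: (U f).
Qed.

Lemma euclid_affine g f : g <> p -> f <> p -> euclidean_program D g f.
Proof.
move=> gp fp; apply: (@no_directed_cycle _ D g f (key g f)) => [X|Z Z' U]; first exact: size_key.
exact: key_edge.
Qed.

Lemma euclidean_lexicographic : euclidean_OM D.
Proof.
move=> g f [gf _ _]; case: (classic (g = p)) => [E|gp].
  by rewrite E; apply: euclid_infinity => fp; apply: gf; rewrite E fp.
case: (classic (f = p)) => [->|fp]; [exact: euclid_objective|exact: euclid_affine].
Qed.
End Lexicographic.

(** * Transfer from the oriented matroid to its extension *)

Lemma lex_sigmaE (T : finType) (es : seq T) alpha (X : signvec (option T)) :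
  size alpha = size es -> lex_sigma es alpha (restr X) = lsign (zip (map Some es) alpha) X.
Proof.
rewrite /lex_sigma /lex_index; elim: es alpha => [|e es IH] [|al alpha] //= [sz].
rewrite ffunE -IH //; case E: (X (Some e)) => //=; by rewrite ffunE E.
Qed.

Section Extension.
Variables (T : finType) (C : {set signvec T}) (D : {set signvec (option T)}).
Variables (sigma : signvec T -> sgn).
Hypotheses (OMC : is_OM C) (ext : is_extension C D sigma).
Let OMD : is_OM D. Proof. by case: ext. Qed.
Let emb X := extendv X (sigma X).
Implicit Types (X Y : signvec T) (Z W : signvec (option T)).

Let embD X : X \in C -> emb X \in D. Proof. by case: ext => _ _ _; apply. Qed.
Let embS X e : emb X (Some e) = X e. Proof. by rewrite ffunE. Qed.

(** Were the new element alone the support of a cocircuit, all embedded cocircuits would vanish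
    there, and adding it to a basis of O would exceed the rank, which the extension preserves. *)
Lemma extension_no_coloop Z : Z \in D -> exists2 k, k <> None & Z k <> Zer.
Proof.
move=> ZD; apply: NNPP => N.
have Zk k : k <> None -> Z k = Zer by move=> kp; apply: NNPP => Zk; apply: N; exists k.
have ZN : Z None <> Zer.
  by have [[e|] //] := om_nz OMD ZD; rewrite Zk.
have embN X : X \in C -> emb X None = Zer.
  move=> XC; apply: NNPP => XN; have [e Xe] := om_nz OMC XC.
  have s : zset (emb X) \subset zset Z.
    by apply/subsetP => -[h _|]; rewrite !inE; [rewrite Zk|move/eqP/XN].
  by have [E|E] := om_incomp OMD (embD XC) ZD s; apply: Xe; move: (Zk (Some e)); rewrite E ?ffunE;
    move=> /(_ (fun e => match e with erefl => I end)); case: (X e).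
have [I [indI _ _ EI]] := mrank_ex OMC [set: T].
have indJ : ind D (None |: (Some @: I)).
  apply/indP => x; rewrite in_setU1 => /orP[/eqP->|/imsetP [e eI ->]].
    apply/negP => /closP/(_ Z ZD) H; apply: ZN; apply: H.
    by apply/subzP => -[h _|]; [apply: Zk|rewrite !inE eqxx].
  have [X [XC sX Xe]] := closPn (indP _ _ indI e eI).
  apply/negP => /closP/(_ (emb X) (embD XC)) H; apply: Xe; rewrite -embS; apply: H.
  apply/subzP => -[h|_]; last exact: embN.
  rewrite !inE /= => /andP[nh /imsetP [h' h'I [E]]]; rewrite embS.
  by apply: (subzP _ _ sX); rewrite !inE E h'I andbT -E; apply: contra nh => /eqP->.
have := mrank_ge OMD indJ (subsetT _).
rewrite cardsU1 (card_imset _ Some_inj) EI; case: ext => _ _ + _; rewrite /om_rank => ->.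
by rewrite (_ : None \notin _) ?add1n ?ltnn //; apply/imsetP => -[].
Qed.

Lemma extension_old Z : old D None Z -> restr Z \in C.
Proof.
case/oldP => ZD H; case: ext => _ <- _ _; rewrite inE; apply/and3P; split.
- have [[e|] // _ Ze] := extension_no_coloop ZD.
  by apply/eqP => /ffunP/(_ e); rewrite !ffunE.
- by apply/existsP; exists Z; rewrite ZD eqxx.
apply/forall_inP => Y YD; apply/implyP => _; apply/negP => /properP [sYZ [e]].
have [|->|->] := H Y YD; last 2 first.
- by rewrite !inE => ->.
- by rewrite !inE !ffunE; case: (Z (Some e)).
apply/subsetP => -[h|]; rewrite !inE //= => /eqP Zh; apply/eqP; apply: NNPP => Yh.
by have := subsetP sYZ h; rewrite !inE !ffunE Zh eqxx; move=> /(_ (introN eqP Yh)).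
Qed.

Lemma extension_sign Z : old D None Z -> Z None = sigma (restr Z).
Proof.
move=> oZ; have ZC := extension_old oZ; case/oldP: oZ => ZD /(_ _ (embD ZC)) [|E|E].
- by apply/subsetP => -[h|]; rewrite !inE // embS ffunE.
- by rewrite -[in LHS]E ffunE.
have [e] := om_nz OMC ZC; rewrite ffunE; move/ffunP/(_ (Some e)): E; rewrite embS !ffunE.
by case: (Z (Some e)).
Qed.

Lemma extension_corank n (A : {set option T}) : None \notin A -> crk D n A ->
  crk C n [set e | Some e \in A].
Proof.
have sub X (B : {set option T}) : None \notin B -> [set e | Some e \in B] \subset zset X -> B \subset zset (emb X).
  move=> NB /subzP s; apply/subzP => -[h hB|]; last by rewrite (negbTE NB).
  by rewrite embS s // inE.
elim: n A => [|n IH] A NA /= H.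
  by move=> X XC; apply: contra (H _ (embD XC)); apply: sub.
move=> e X XC sX Xe; have := IH (Some e |: A).
have -> : [set e0 | Some e0 \in Some e |: A] = e |: [set e0 | Some e0 \in A].
  by apply/setP => h; rewrite !inE.
apply; first by rewrite in_setU1.
by apply: (H (Some e) (emb X)); rewrite ?embD ?embS ?sub.
Qed.

Lemma extension_potential g f : euclidean_OM C -> g <> None -> f <> None ->
  exists h, old_potential D None g f h.
Proof.
case: g => [g|] //; case: f => [f|] // EC _ _.
have [h [hs hl]] := euclid_potential OMC g f EC.
exists (fun Z => h (restr Z)); split=> [X oX Xg|A X Y W NA lA oX oY oW olX olY Xg XYg Wg S].
  by rewrite hs ?ffunE.
have olW : old D None W.
  have NgA : None \notin Some g |: A by rewrite in_setU1.
  apply: (old_pt OMD extension_no_coloop NgA _ (onU1 oW Wg)).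
  by apply: lA Xg; [apply: onD oX|case/andP: oX].
have on' Z : old D None Z -> on D A Z -> on C [set e | Some e \in A] (restr Z).
  move=> olZ oZ; rewrite /on extension_old //; apply/subzP => e; rewrite inE ffunE.
  exact: (on0 oZ).
rewrite (hl _ _ _ (restr W) (extension_corank NA lA)) ?on' //.
all: by rewrite ?ffunE // => e; rewrite !ffunE.
Qed.

End Extension.

Theorem theorem1p2 (T : finType) (C : {set signvec T})
    (C' : {set signvec (option T)}) (es : seq T) (alpha : seq sgn) :
  is_OM C -> euclidean_OM C ->
  is_lex_extension C C' es alpha ->
  euclidean_OM C'.
Proof.
move=> OMC EC [_ sz /allP al0 ext]; have OMD : is_OM C' by case: ext.
apply: (@euclidean_lexicographic _ C' None (zip (map Some es) alpha) OMD).
- exact: extension_no_coloop OMC ext.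
- move=> -[x s] /= H; split.
    have : x \in map Some es by rewrite -[map _ _](@unzip1_zip _ _ _ alpha) ?size_map ?sz //; apply: (map_f fst H).
    by case/mapP => e _ ->.
  apply/eqP; apply: al0; rewrite -(@unzip2_zip _ _ (map Some es) alpha) ?size_map ?sz //.
  exact: (map_f snd H).
- by move=> X oX; rewrite (extension_sign OMC ext oX) lex_sigmaE.
by move=> g f gp fp; apply: (extension_potential OMC ext EC).
Qed.
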